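(* Let $\{c_n\}_{n\ge 1}\subset(0,\infty)$ with $\lim_{n\to\infty}c_n=0$, let $\{a_n\}_{n\ge1}\subset\mathbb{C}$, and let $D(s):=\sum_{n=1}^\infty a_n c_n^s$ be a Dirichlet series that converges absolutely in the half-plane $\mathcal{P}_0=\{s\in\mathbb{C}:\operatorname{Re}(s)>S_0\}$ for some $S_0\in\mathbb{R}$, and extends meromorphically to $\mathbb{C}$. Let $\sigma>0$. Let $\Gamma$ be a bounded sector containing the set $\{c_n\}$, and let $h:\Gamma\to\mathbb{C}$ be a function for which there are $\{\alpha_j\}_{j\ge1}\subset\mathbb{C}$ and an increasing sequence $\{\sigma_j\}_{j\ge1}\subset(0,\infty)$ with $\sigma_j\nearrow\infty$ such that for every $N$ there exists $C_N>1$ with $$\left|h(z)-\sum_{j=1}^N\alpha_j z^{\sigma_j}\right|\le C_N|z|^{\sigma_{N+1}}\qquad\text{for all }z\in\Gamma.$$ Then the sum $\sum_{n=1}^\infty a_n\left(c_n^{\sigma}(1+h(c_n))\right)^s$ extends meromorphically to $\mathbb{C}$ as well.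
   Context: A bounded sector is a set of the form $\Gamma=\{re^{it}: r\in[0,\varepsilon],\ t\in[t_1,t_2]\}$ with $\varepsilon>0$ and $0\le t_2-t_1<2\pi$. Non-integer powers $z^{\sigma_j}$ on $\Gamma$ are taken with a branch of the logarithm on $\Gamma\setminus\{0\}$ that is real on the positive real axis, and $0^{\sigma_j}=0$. For $c>0$, $c^s=\exp(s\log c)$ with the real logarithm. The perturbed powers are $\left(c_n^{\sigma}(1+h(c_n))\right)^s:=c_n^{\sigma s}(1+h(c_n))^s$, where $1+h(c_n)\neq0$ for all $n$, and $(1+h(c_n))^s$ is defined with the principal branch of the logarithm whenever $|h(c_n)|<1$ (which holds for all but finitely many $n$) and with any fixed choice of logarithm of $1+h(c_n)$ for the finitely many remaining $n$. A series of functions of $s$ that converges absolutely on a half-plane $P$ ''extends meromorphically to $\mathbb{C}$'' if there is a function $g$ meromorphic on $\mathbb{C}$ that agrees with the sum of the series on $P$. For $D$ the half-plane is $\mathcal{P}_0$; for the perturbed sum it is $\{s:\operatorname{Re}(s)>S_0/\sigma\}$. *)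

(* Defs.v *)
From Stdlib Require Import Reals.
From Coquelicot Require Import Coquelicot.
Open Scope R_scope.

Definition Cexp (z : C) : C := (RtoC (exp (Re z)) * (cos (Im z), sin (Im z)))%C.

(* [c^s] for [c > 0], with the real logarithm of [c]. *)
Definition pos_cpow (c : R) (s : C) : C := Cexp (s * RtoC (ln c))%C.

(* Stdlib has [Rpower 0 y = 1], hence the separate case. *)
Definition rpow0 (x y : R) : R :=
  if Req_dec_T x 0 then 0 else Rpower x y.

Definition is_principal_log (w l : C) : Prop :=
  Cexp l = w /\ - PI < Im l <= PI.

Definition sector (eps t1 t2 : R) (z : C) : Prop :=
  exists r t : R, 0 <= r <= eps /\ t1 <= t <= t2 /\
    z = (RtoC r * Cexp (Ci * RtoC t))%C.

Definition log_branch (U : C -> Prop) (L : C -> C) : Prop :=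
  (forall z : C, U z -> Cexp (L z) = z) /\
  (forall z : C, U z -> filterlim L (within U (locally z)) (locally (L z))) /\
  (forall x : R, 0 < x -> U (RtoC x) -> Im (L (RtoC x)) = 0).

Definition branch_pow (L : C -> C) (z : C) (y : R) : C :=
  if Ceq_dec z 0 then RtoC 0 else Cexp (RtoC y * L z)%C.

Definition holomorphic_at (f : C -> C) (z : C) : Prop :=
  @ex_derive C_AbsRing C_NormedModule f z.

(* [p] is a pole of order at most [m], for some [m].  The case of a removable
   singularity is admitted: functions being total, the value of [g] at a
   singularity carries no information. *)
Definition at_most_pole (g : C -> C) (p : C) : Prop :=
  exists (m : nat) (phi : C -> C),
    locally p (holomorphic_at phi) /\
    locally' p (fun z : C => g z = (phi z / (z - p) ^ m)%C).

(* Meromorphic on the whole plane: holomorphic off a set [S] without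
   accumulation points in [C], with at most poles at the points of [S]. *)
Definition meromorphic (g : C -> C) : Prop :=
  exists S : C -> Prop,
    (forall z : C, locally' z (fun w : C => ~ S w)) /\
    (forall z : C, ~ S z -> holomorphic_at g z) /\
    (forall p : C, S p -> at_most_pole g p).

Definition half_plane (S0 : R) (s : C) : Prop := S0 < Re s.

Definition converges_absolutely_on (P : C -> Prop) (u : nat -> C -> C) : Prop :=
  forall s : C, P s -> ex_series (fun n : nat => Cmod (u n s)).

Definition extends_meromorphically (P : C -> Prop) (u : nat -> C -> C) : Prop :=
  exists g : C -> C, meromorphic g /\
    forall s : C, P s ->
      @is_series C_AbsRing C_NormedModule (fun n : nat => u n s) (g s).

(* Main.v *)
Require Import Defs.
From Stdlib Require Import Arith Reals Lra Lia Classical IndefiniteDescription.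
From Coquelicot Require Import Coquelicot.
Open Scope R_scope.

(** Why the sums extend.

Formally, exp (s * ell_n) is the sum over k of s^k / k! * ell_n^k, so the
perturbed sum is the sum over k of s^k / k! * F_k (sigma * s), where F_k
continues the Dirichlet series with coefficients a_n * ell_n^k.  Since ell_n is
O(c_n^m) for some m > 0, the k-th of these series converges on a half-plane
whose abscissa moves to the left by m at each step, and so does the series of
Taylor remainders.  Truncating at larger and larger orders therefore reaches the
whole plane.

That the truncations fit together is the content of [glue].  Passing from order
N to order N + 1 adds the term T_(N+1) and removes the series of the t_(N+1)
from the remainder; the remainder only makes sense to the right of the abscissa
x_(N+1), and there T_(N+1) is the sum of that series.  So consecutive truncations
coincide, by direct comparison of sums, on the entire half-plane on which the
coarser one is considered.

To obtain the F_k, call a sequence q a multiplier of order m if multiplying the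
coefficients by q turns any continuable Dirichlet series into a continuable one
with abscissa smaller by m ([multiplier]).  The powers c_n^t are multipliers of
order t, by translating the variable; products of multipliers are multipliers;
and, by [glue] again, so is every sequence with an asymptotic expansion in
multipliers of orders tending to infinity ([multiplier_asymptotic]).  Applied to
the expansion of h, this makes h(c_n) a multiplier; applied to
log (1 + h) = h - h^2 / 2 + ..., it makes ell_n a multiplier ([multiplier_log]),
hence also its powers.

The analysis behind this is the mean value inequality [Cmean_value]: it bounds
the Taylor remainders of exp and log, and gives the holomorphy of a series of
functions whose derivatives are dominated by a summable sequence
([series_holomorphic]). *)

(** * Complex derivatives and the mean value inequality *)

Definition is_Cderive (f : C -> C) (z d : C) : Prop :=
  @is_derive C_AbsRing C_NormedModule f z d.

Lemma locally_Cmod (p : C) (P : C -> Prop) :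
  locally p P <-> exists r, 0 < r /\ forall w, Cmod (w - p) < r -> P w.
Proof.
split.
- intros H. apply (@locally_norm_le_locally C_AbsRing C_NormedModule p P) in H.
  destruct H as [e He]. exists e. split; [apply cond_pos|]. exact He.
- intros [r [Hr H]]. apply (@locally_le_locally_norm C_AbsRing C_NormedModule p P).
  exists (mkposreal r Hr). exact H.
Qed.

Lemma is_Cderive_eps (f : C -> C) (z d : C) :
  is_Cderive f z d <->
  forall eps, 0 < eps -> exists r, 0 < r /\ forall w, Cmod (w - z) < r ->
    Cmod (f w - f z - (w - z) * d) <= eps * Cmod (w - z).
Proof.
split.
- intros [_ H] eps He.
  destruct (H z (fun P HP => HP) (mkposreal eps He)) as [r Hr].
  exists r. split; [apply cond_pos|]. exact Hr.
- intros H. split.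
  + apply is_linear_scal_l.
  + intros x Hx eps.
    apply (@is_filter_lim_locally_unique C_AbsRing (AbsRing_NormedModule C_AbsRing)) in Hx.
    subst x. destruct (H eps (cond_pos eps)) as [r [Hr H1]].
    exists (mkposreal r Hr). exact H1.
Qed.

(** The target of the derivative may carry either of two norm structures on the
complex numbers: the one of the ring, for which the product rule and the chain
rule are stated, or the one of [holomorphic_at].  Both say the same about a
derivative, because they have the same norm. *)
Lemma is_Cderive_absring (f : C -> C) (z d : C) :
  is_Cderive f z d <-> @is_derive C_AbsRing (AbsRing_NormedModule C_AbsRing) f z d.
Proof.
rewrite is_Cderive_eps. split.
- intros H. split.
  + apply is_linear_scal_l.
  + intros x Hx eps.
    apply (@is_filter_lim_locally_unique C_AbsRing (AbsRing_NormedModule C_AbsRing)) in Hx.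
    subst x. destruct (H eps (cond_pos eps)) as [r [Hr H1]].
    exists (mkposreal r Hr). exact H1.
- intros [_ H] eps He.
  destruct (H z (fun P HP => HP) (mkposreal eps He)) as [r Hr].
  exists r. split; [apply cond_pos|]. exact Hr.
Qed.

Lemma is_Cderive_const (a z : C) : is_Cderive (fun _ => a) z 0.
Proof. exact (is_derive_const (K := C_AbsRing) (V := C_NormedModule) a z). Qed.

Lemma is_Cderive_id (z : C) : is_Cderive (fun w => w) z 1.
Proof. apply is_Cderive_absring. exact (is_derive_id (K := C_AbsRing) z). Qed.

Lemma is_Cderive_plus (f g : C -> C) (z df dg : C) :
  is_Cderive f z df -> is_Cderive g z dg ->
  is_Cderive (fun w => f w + g w)%C z (df + dg).
Proof. exact (is_derive_plus (K := C_AbsRing) (V := C_NormedModule) f g z df dg). Qed.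

Lemma is_Cderive_minus (f g : C -> C) (z df dg : C) :
  is_Cderive f z df -> is_Cderive g z dg ->
  is_Cderive (fun w => f w - g w)%C z (df - dg).
Proof. exact (is_derive_minus (K := C_AbsRing) (V := C_NormedModule) f g z df dg). Qed.

Lemma is_Cderive_mult (f g : C -> C) (z df dg : C) :
  is_Cderive f z df -> is_Cderive g z dg ->
  is_Cderive (fun w => f w * g w)%C z (df * g z + f z * dg).
Proof.
rewrite !is_Cderive_absring. intros Hf Hg.
exact (is_derive_mult (K := C_AbsRing) f g z df dg Hf Hg Cmult_comm).
Qed.

Lemma is_Cderive_comp (f g : C -> C) (z df dg : C) :
  is_Cderive f (g z) df -> is_Cderive g z dg ->
  is_Cderive (fun w => f (g w)) z (dg * df).
Proof.
intros Hf Hg. apply is_Cderive_absring in Hg.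
exact (is_derive_comp (K := C_AbsRing) (V := C_NormedModule) f g z df dg Hf Hg).
Qed.

Lemma is_Cderive_ext_loc (f g : C -> C) (z d : C) :
  locally z (fun w => f w = g w) -> is_Cderive f z d -> is_Cderive g z d.
Proof.
rewrite locally_Cmod, !is_Cderive_eps. intros [r [Hr E]] H eps He.
destruct (H eps He) as [r' [Hr' H']].
exists (Rmin r r'). split; [now apply Rmin_glb_lt|]. intros w Hw.
rewrite <- (E w), <- (E z).
- apply H'. eapply Rlt_le_trans; [exact Hw|apply Rmin_r].
- replace (z - z)%C with (RtoC 0) by ring. now rewrite Cmod_0.
- eapply Rlt_le_trans; [exact Hw|apply Rmin_l].
Qed.

Lemma is_Cderive_eq (f : C -> C) (z d d' : C) :
  is_Cderive f z d -> d = d' -> is_Cderive f z d'.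
Proof. now intros H <-. Qed.

Lemma Re_Cmod_le (z : C) : Rabs (Re z) <= Cmod z.
Proof. eapply Rle_trans; [apply Rmax_l|apply Rmax_Cmod]. Qed.
Lemma Im_Cmod_le (z : C) : Rabs (Im z) <= Cmod z.
Proof. eapply Rle_trans; [apply Rmax_r|apply Rmax_Cmod]. Qed.

(** Restricting to a segment and applying a real linear form [Re (k * _)] reduces
complex derivatives to real ones. *)
Lemma is_Cderive_segment (f : C -> C) (a v k d : C) (t : R) :
  is_Cderive f (a + RtoC t * v) d ->
  is_derive (fun t : R => Re (k * f (a + RtoC t * v)))%C t (Re (k * (v * d)))%C.
Proof.
intros H. rewrite is_Cderive_eps in H.
split; [apply is_linear_scal_l|].
intros x Hx eps.
apply (@is_filter_lim_locally_unique R_AbsRing R_NormedModule) in Hx. subst x.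
assert (Hk : 0 < Cmod k * Cmod v + 1).
{ pose proof (Cmod_ge_0 k). pose proof (Cmod_ge_0 v). nra. }
assert (Hv : 0 < Cmod v + 1).
{ pose proof (Cmod_ge_0 v). lra. }
destruct (H (eps / (Cmod k * Cmod v + 1))) as [r [Hr H1]].
{ apply Rdiv_lt_0_compat; [apply cond_pos|exact Hk]. }
assert (Hr' : 0 < r / (Cmod v + 1)) by now apply Rdiv_lt_0_compat.
exists (mkposreal _ Hr'). intros y Hy.
change (Rabs (y - t) < r / (Cmod v + 1)) in Hy.
change (Rabs (Re (k * f (a + RtoC y * v))%C - Re (k * f (a + RtoC t * v))%C - (y - t) * Re (k * (v * d))%C)
   <= eps * Rabs (y - t)).
replace (Re (k * f (a + RtoC y * v))%C - Re (k * f (a + RtoC t * v))%C - (y - t) * Re (k * (v * d))%C)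
  with (Re (k * (f (a + RtoC y * v) - f (a + RtoC t * v) - ((a + RtoC y * v) - (a + RtoC t * v)) * d))%C).
2:{ unfold Re. simpl. ring. }
assert (E : Cmod ((a + y * v) - (a + t * v))%C = Rabs (y - t) * Cmod v).
{ replace ((a + y * v) - (a + t * v))%C with (RtoC (y - t) * v)%C.
  - now rewrite Cmod_mult, Cmod_R.
  - rewrite RtoC_minus. ring. }
eapply Rle_trans; [apply Re_Cmod_le|]. rewrite Cmod_mult.
assert (H2 := H1 (a + y * v)%C). rewrite E in H2.
pose proof (Cmod_ge_0 k) as Gk. pose proof (Cmod_ge_0 v) as Gv.
pose proof (Rabs_pos (y - t)) as Ga.
eapply Rle_trans; [apply Rmult_le_compat_l; [exact Gk|apply H2]|].
- apply (Rmult_lt_compat_r (Cmod v + 1)) in Hy; [|exact Hv].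
  replace (r / (Cmod v + 1) * (Cmod v + 1)) with r in Hy by (field; lra). nra.
- replace (Cmod k * (eps / (Cmod k * Cmod v + 1) * (Rabs (y - t) * Cmod v)))
   with (eps * Rabs (y - t) * ((Cmod k * Cmod v) / (Cmod k * Cmod v + 1))) by (field; lra).
  rewrite <- (Rmult_1_r (eps * Rabs (y - t))) at 2.
  apply Rmult_le_compat_l.
  + apply Rmult_le_pos; [apply Rlt_le, cond_pos|exact Ga].
  + apply Rmult_le_reg_r with (Cmod k * Cmod v + 1); [exact Hk|].
    unfold Rdiv. rewrite Rmult_assoc, Rinv_l; nra.
Qed.

(** With k the conjugate of f b - f a, the real function Re (k * f) along the
segment increases by exactly |f b - f a|^2, so that the real mean value theorem
applies and one factor |f b - f a| cancels. *)
Lemma Cmean_value (f f' : C -> C) (D : R) (a b : C) :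
  (forall t, 0 <= t <= 1 ->
     is_Cderive f (a + RtoC t * (b - a)) (f' (a + RtoC t * (b - a))%C) /\
     Cmod (f' (a + RtoC t * (b - a))%C) <= D) ->
  Cmod (f b - f a) <= D * Cmod (b - a).
Proof.
intros H.
set (k := Cconj (f b - f a)).
set (g := fun t : R => Re (k * f (a + RtoC t * (b - a)))%C).
assert (E : g 1 - g 0 = Cmod (f b - f a) * Cmod (f b - f a)).
{ unfold g. replace (a + 1 * (b - a))%C with b by ring.
  replace (a + 0 * (b - a))%C with a by ring.
  assert (S := Cmod2_conj (f b - f a)%C). fold k in S.
  replace (Re (k * f b)%C - Re (k * f a)%C) with (Re ((f b - f a) * k)%C)
   by (unfold Re; simpl; ring).
  rewrite <- S. simpl. ring. }
destruct (MVT_gen g 0 1 (fun t => Re (k * ((b - a) * f' (a + RtoC t * (b - a))%C))%C))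
  as [c [Hc Hg]].
- intros x Hx. rewrite Rmin_left, Rmax_right in Hx by lra.
  apply is_Cderive_segment. apply H. lra.
- intros x Hx. rewrite Rmin_left, Rmax_right in Hx by lra.
  apply continuity_pt_filterlim.
  apply (ex_derive_continuous (V := R_NormedModule) g).
  eexists. apply is_Cderive_segment. apply H. lra.
- rewrite Rmin_left, Rmax_right in Hc by lra.
  rewrite E in Hg.
  assert (B : Cmod (f b - f a) * Cmod (f b - f a) <=
              Cmod (f b - f a) * (D * Cmod (b - a))).
  { rewrite Hg. rewrite Rminus_0_r, Rmult_1_r.
    eapply Rle_trans; [apply Rle_abs|].
    eapply Rle_trans; [apply Re_Cmod_le|].
    rewrite !Cmod_mult. unfold k. rewrite Cmod_conj.
    apply Rmult_le_compat_l; [apply Cmod_ge_0|].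
    rewrite Rmult_comm. apply Rmult_le_compat_r; [apply Cmod_ge_0|].
    apply H; lra. }
  destruct (Cmod_ge_0 (f b - f a)) as [P|P].
  + now apply Rmult_le_reg_l in B.
  + rewrite <- P. apply Rmult_le_pos; [|apply Cmod_ge_0].
    eapply Rle_trans; [apply Cmod_ge_0|apply (H 0); lra].
Qed.

(** * The exponential and its Taylor remainders *)

Local Notation Csum_n := (@sum_n C_AbelianMonoid) (only parsing).

Lemma Csum_Sn (f : nat -> C) (N : nat) : Csum_n f (S N) = (Csum_n f N + f (S N))%C.
Proof. exact (sum_Sn f N). Qed.
Lemma Csum_O (f : nat -> C) : Csum_n f 0 = f 0%nat.
Proof. exact (sum_O f). Qed.

Lemma Cexp_plus (z w : C) : Cexp (z + w) = (Cexp z * Cexp w)%C.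
Proof.
unfold Cexp. destruct z as [x y], w as [x' y']; unfold Re, Im; simpl.
rewrite exp_plus, cos_plus, sin_plus. unfold Cmult, RtoC; simpl. f_equal; ring.
Qed.

Lemma Cexp_0 : Cexp 0 = 1.
Proof. unfold Cexp, Re, Im; simpl. rewrite exp_0, cos_0, sin_0. unfold Cmult, RtoC; simpl. f_equal; ring. Qed.

Lemma Cmod_Cexp (z : C) : Cmod (Cexp z) = exp (Re z).
Proof.
unfold Cexp. rewrite Cmod_mult, Cmod_R, Rabs_pos_eq by apply Rlt_le, exp_pos.
unfold Cmod; simpl. replace (_ + _) with 1.
- rewrite sqrt_1; ring.
- pose proof (sin2_cos2 (Im z)) as H. unfold Rsqr in H. simpl. lra.
Qed.

Lemma Cmod_Cexp_le (z : C) : Cmod (Cexp z) <= exp (Cmod z).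
Proof.
rewrite Cmod_Cexp. destruct (Rle_lt_or_eq_dec (Re z) (Cmod z)) as [H|H].
- eapply Rle_trans; [apply Rle_abs|apply Re_Cmod_le].
- now apply Rlt_le, exp_increasing.
- rewrite <- H at 1. lra.
Qed.

Lemma derive_eps (f : R -> R) (x l : R) : derivable_pt_lim f x l ->
  forall eps, 0 < eps -> exists r, 0 < r /\ forall h, Rabs h < r ->
   Rabs (f (x + h) - f x - l * h) <= eps * Rabs h.
Proof.
intros H eps He. destruct (H eps He) as [r Hr].
exists r. split; [apply cond_pos|]. intros h Hh.
destruct (Req_dec h 0) as [->|H0].
- rewrite Rplus_0_r, Rmult_0_r, Rminus_eq_0, Rminus_0_r, Rabs_R0. lra.
- specialize (Hr h H0 Hh). replace (f (x + h) - f x - l * h) with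
   (((f (x + h) - f x) / h - l) * h) by (field; exact H0).
  rewrite Rabs_mult. apply Rmult_le_compat_r; [apply Rabs_pos|lra].
Qed.

Lemma Cmod_le_Re_Im (z : C) : Cmod z <= Rabs (Re z) + Rabs (Im z).
Proof.
replace z with (RtoC (Re z) + Ci * RtoC (Im z))%C at 1.
- eapply Rle_trans; [apply Cmod_triangle|].
  rewrite Cmod_mult, !Cmod_R, Cmod_Ci. lra.
- destruct z; unfold Re, Im, Cplus, Cmult, Ci, RtoC; simpl. f_equal; ring.
Qed.

(** By the addition formula it is enough to treat the point 0, where the
estimate follows from the real derivatives of exp, sin and cos at 0. *)
Lemma is_Cderive_Cexp (z : C) : is_Cderive Cexp z (Cexp z).
Proof.
apply is_Cderive_eps. intros eps He.
assert (HM : 0 < exp (Re z)) by apply exp_pos.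
(* The estimate below loses a factor 8, and exp (Re z) is the modulus of Cexp z. *)
set (e := Rmin 1 (eps / (8 * exp (Re z)))).
assert (He0 : 0 < e).
{ apply Rmin_glb_lt; [lra|]. apply Rdiv_lt_0_compat; lra. }
assert (He1 : e <= 1) by apply Rmin_l.
assert (He2 : exp (Re z) * (8 * e) <= eps).
{ assert (e <= eps / (8 * exp (Re z))) as H by apply Rmin_r.
  apply (Rmult_le_compat_r (8 * exp (Re z))) in H; [|lra].
  replace (eps / (8 * exp (Re z)) * (8 * exp (Re z))) with eps in H by (field; lra). lra. }
assert (Dexp : derivable_pt_lim exp 0 1) by (pose proof (derivable_pt_lim_exp 0) as H; now rewrite exp_0 in H).
assert (Dsin : derivable_pt_lim sin 0 1) by (rewrite <- cos_0; apply derivable_pt_lim_sin).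
assert (Dcos : derivable_pt_lim cos 0 0).
{ pose proof (derivable_pt_lim_cos 0) as H. now rewrite sin_0, Ropp_0 in H. }
clearbody e.
destruct (derive_eps exp 0 1 Dexp e He0) as [r1 [R1 H1]].
destruct (derive_eps sin 0 1 Dsin e He0) as [r2 [R2 H2]].
destruct (derive_eps cos 0 0 Dcos e He0) as [r3 [R3 H3]].
exists (Rmin e (Rmin r1 (Rmin r2 r3))).
split; [repeat apply Rmin_glb_lt; assumption|].
intros w Hw.
set (h := (w - z)%C) in *.
replace w with (z + h)%C by (unfold h; ring). rewrite Cexp_plus.
replace (Cexp z * Cexp h - Cexp z - h * Cexp z)%C with (Cexp z * (Cexp h - 1 - h))%C by ring.
rewrite Cmod_mult, Cmod_Cexp.
assert (Cmod (Cexp h - 1 - h) <= 8 * e * Cmod h) as K.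
2:{ pose proof (Cmod_ge_0 h).
    apply Rle_trans with (exp (Re z) * (8 * e * Cmod h)).
    - apply Rmult_le_compat_l; lra.
    - replace (exp (Re z) * (8 * e * Cmod h)) with (exp (Re z) * (8 * e) * Cmod h) by ring.
      apply Rmult_le_compat_r; lra. }
apply Rmin_Rgt in Hw as [W0 Hw]. apply Rmin_Rgt in Hw as [W1 Hw]. apply Rmin_Rgt in Hw as [W2 W3].
pose proof (Re_Cmod_le h) as Kx. pose proof (Im_Cmod_le h) as Ky.
destruct h as [x y]. unfold Re, Im in Kx, Ky; simpl fst in *; simpl snd in *.
set (m := Cmod (x, y)) in *.
specialize (H1 x ltac:(lra)). specialize (H2 y ltac:(lra)). specialize (H3 y ltac:(lra)).
rewrite Rplus_0_l in H1, H2, H3. rewrite exp_0, Rmult_1_l in H1.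
rewrite sin_0, Rminus_0_r, Rmult_1_l in H2. rewrite cos_0, Rmult_0_l, Rminus_0_r in H3.
eapply Rle_trans; [apply Cmod_le_Re_Im|].
unfold Cexp, Re, Im; simpl.
set (A := exp x - 1 - x) in *. set (B := sin y - y) in *. set (D := cos y - 1) in *.
replace (exp x * cos y - 0 * sin y + - (1) + - x) with (A * cos y + (1 + x) * D)
 by (unfold A, D; ring).
replace (exp x * sin y + 0 * cos y + -0 + - y) with ((A + x) * (B + y) + B)
 by (unfold A, B; ring).
assert (Hm : 0 <= m) by apply Cmod_ge_0.
assert (Hc : Rabs (cos y) <= 1) by (apply Rabs_le; apply COS_bound).
assert (T1 : Rabs (A * cos y + (1 + x) * D) <= e * m + 2 * (e * m)).
{ eapply Rle_trans; [apply Rabs_triang|]. rewrite !Rabs_mult.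
  pose proof (Rabs_pos A). pose proof (Rabs_pos D). pose proof (Rabs_pos (cos y)).
  assert (Rabs (1 + x) <= 2).
  { eapply Rle_trans; [apply Rabs_triang|]. rewrite Rabs_R1. lra. }
  assert (Rabs A <= e * m) by (eapply Rle_trans; [apply H1|apply Rmult_le_compat_l; lra]).
  assert (Rabs D <= e * m) by (eapply Rle_trans; [apply H3|apply Rmult_le_compat_l; lra]).
  apply Rplus_le_compat.
  - rewrite <- (Rmult_1_r (e * m)). apply Rmult_le_compat; lra.
  - apply Rmult_le_compat; try lra. apply Rabs_pos. }
assert (T2 : Rabs ((A + x) * (B + y) + B) <= 4 * (e * m) + e * m).
{ eapply Rle_trans; [apply Rabs_triang|]. rewrite !Rabs_mult.
  assert (Rabs A <= m) by (eapply Rle_trans; [apply H1|]; pose proof (Rabs_pos x); nra).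
  assert (Rabs B <= e * m) by (eapply Rle_trans; [apply H2|apply Rmult_le_compat_l; lra]).
  assert (Rabs (A + x) <= 2 * e).
  { eapply Rle_trans; [apply Rabs_triang|]. lra. }
  assert (Rabs (B + y) <= 2 * m).
  { eapply Rle_trans; [apply Rabs_triang|]. nra. }
  apply Rplus_le_compat; [|assumption].
  replace (4 * (e * m)) with ((2 * e) * (2 * m)) by ring.
  apply Rmult_le_compat; try assumption; apply Rabs_pos. }
lra.
Qed.

Lemma is_Cderive_pow (m : nat) (z : C) :
  is_Cderive (fun w => w ^ (S m))%C z (RtoC (INR (S m)) * z ^ m).
Proof.
induction m as [|m IH].
- eapply is_Cderive_eq.
  + apply (is_Cderive_ext_loc (fun w => w)); [|apply is_Cderive_id].
    apply filter_forall. intros w. now rewrite Cpow_1_r.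
  + simpl. ring.
- eapply is_Cderive_eq.
  + apply (is_Cderive_mult (fun w => w) (fun w => w ^ (S m))%C); [apply is_Cderive_id|exact IH].
  + rewrite (S_INR (S m)), RtoC_plus, (Cpow_S z m). ring.
Qed.

(** Taylor remainder of the exponential after the terms of degree < m.  Starting
at m = 0 with the exponential itself makes each remainder the derivative of the
next one. *)
Fixpoint exp_rem (m : nat) (w : C) : C :=
  match m with
  | O => Cexp w
  | S m => (exp_rem m w - w ^ m / RtoC (INR (fact m)))%C
  end.

Lemma exp_rem_sum (N : nat) (w : C) :
  exp_rem (S N) w = (Cexp w - Csum_n (fun k => w ^ k / RtoC (INR (fact k))) N)%C.
Proof.
induction N as [|N IH].
- now rewrite Csum_O.
- rewrite Csum_Sn.
  change (exp_rem (S (S N)) w) with (exp_rem (S N) w - w ^ S N / RtoC (INR (fact (S N))))%C.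
  rewrite IH. ring.
Qed.

Lemma INR_fact_C (m : nat) : RtoC (INR (fact m)) <> 0.
Proof. intros E. apply RtoC_inj in E. now apply (INR_fact_neq_0 m). Qed.

Lemma is_Cderive_exp_rem (m : nat) (z : C) :
  is_Cderive (exp_rem m) z (exp_rem (pred m) z).
Proof.
destruct m as [|m]; [apply is_Cderive_Cexp|]. simpl pred.
induction m as [|m IH].
- eapply is_Cderive_eq.
  + apply (is_Cderive_minus Cexp (fun w => w ^ 0 / RtoC (INR (fact 0)))%C).
    * apply is_Cderive_Cexp.
    * apply (is_Cderive_const (1 / RtoC (INR (fact 0)))%C).
  + simpl. ring.
- eapply is_Cderive_eq.
  + apply (is_Cderive_minus (exp_rem (S m)) (fun w => w ^ S m * / RtoC (INR (fact (S m))))%C).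
    * exact IH.
    * apply (is_Cderive_mult _ (fun _ => / RtoC (INR (fact (S m))))%C).
      -- apply is_Cderive_pow.
      -- apply is_Cderive_const.
  + change (exp_rem (S m) z) with (exp_rem m z - z ^ m / RtoC (INR (fact m)))%C.
    pose proof (INR_fact_C m). rewrite fact_simpl, mult_INR, RtoC_mult.
    assert (RtoC (INR (S m)) <> 0).
    { intros E. apply RtoC_inj in E. now apply (not_0_INR (S m)). }
    field. now split.
Qed.

Lemma exp_rem_0 (m : nat) : exp_rem (S m) 0 = 0.
Proof.
induction m as [|m IH].
- simpl. rewrite Cexp_0. field.
- change (exp_rem (S (S m)) 0) with (exp_rem (S m) 0 - 0 ^ S m / RtoC (INR (fact (S m))))%C.
  rewrite IH, Cpow_S. field. apply INR_fact_C.
Qed.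

(** Each remainder vanishes at 0 and has the preceding one as derivative, so the
mean value inequality gains one power of |w| at each step. *)
Lemma exp_rem_bound (m : nat) (w : C) :
  Cmod (exp_rem m w) <= Cmod w ^ m * exp (Cmod w).
Proof.
revert w. induction m as [|m IH]; intros w.
- simpl. rewrite Rmult_1_l. apply Cmod_Cexp_le.
- replace (exp_rem (S m) w) with (exp_rem (S m) w - exp_rem (S m) 0)%C
    by (rewrite exp_rem_0; ring).
  replace (Cmod w ^ S m * exp (Cmod w)) with (Cmod w ^ m * exp (Cmod w) * Cmod (w - 0)).
  2:{ replace (w - 0)%C with w by ring. simpl. ring. }
  apply Cmean_value with (f' := exp_rem m).
  intros t Ht. split; [apply (is_Cderive_exp_rem (S m))|].
  replace (0 + t * (w - 0))%C with (RtoC t * w)%C by ring.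
  assert (L : Cmod (t * w) <= Cmod w).
  { rewrite Cmod_mult, Cmod_R, Rabs_pos_eq by lra. pose proof (Cmod_ge_0 w). nra. }
  eapply Rle_trans; [apply IH|].
  apply Rmult_le_compat.
  + apply pow_le, Cmod_ge_0.
  + apply Rlt_le, exp_pos.
  + apply pow_incr. split; [apply Cmod_ge_0|exact L].
  + destruct L as [L|L]; [now apply Rlt_le, exp_increasing|rewrite L; lra].
Qed.

(** * Taylor polynomials of the principal logarithm *)

(** From the Taylor bound y - y^3 / 6 <= sin y. *)
Lemma sin_ge_third (y : R) : 0 <= y <= 2 -> y / 3 <= sin y.
Proof.
intros [H0 H2]. destruct (pre_sin_bound y 0 H0 ltac:(lra)) as [H _].
eapply Rle_trans; [|exact H].
unfold sin_approx, sin_term; simpl. nra.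
Qed.

(** Quantitative injectivity of exp near 0 in the strip |Im w| <= pi: there, exp w
is close to 1 only if w is close to 0.  It replaces an explicit formula for the
principal logarithm. *)
Lemma log_near_one (w : C) (d : R) :
  Cmod (Cexp w - 1) <= d -> d <= / 2 -> Rabs (Im w) <= PI -> Cmod w <= 8 * d.
Proof.
intros H Hd HI.
assert (Hd0 : 0 <= d) by (eapply Rle_trans; [apply Cmod_ge_0|exact H]).
pose proof (Rle_trans _ _ _ (Re_Cmod_le _) H) as HRe.
pose proof (Rle_trans _ _ _ (Im_Cmod_le _) H) as HIm.
assert (HM : 1 - d <= exp (Re w) <= 1 + d).
{ rewrite <- Cmod_Cexp. split.
  - assert (T := Cmod_triangle (Cexp w) (1 - Cexp w)).
    replace (Cexp w + (1 - Cexp w))%C with (RtoC 1) in T by ring.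
    rewrite Cmod_1 in T. replace (1 - Cexp w)%C with (- (Cexp w - 1))%C in T by ring.
    rewrite Cmod_opp in T. lra.
  - replace (Cexp w) with (Cexp w - 1 + 1)%C by ring.
    eapply Rle_trans; [apply Cmod_triangle|]. rewrite Cmod_1. lra. }
destruct w as [x y]. unfold Cexp, Re, Im in *; simpl in *.
rewrite !Rmult_0_l in *.
assert (Hx : Rabs x <= 2 * d).
{ apply Rabs_le. split.
  - assert (exp (- x) <= 1 + 2 * d).
    { rewrite exp_Ropp. apply Rmult_le_reg_l with (exp x); [lra|].
      rewrite Rinv_r by lra. nra. }
    pose proof (exp_ineq1_le (- x)). lra.
  - pose proof (exp_ineq1_le x). lra. }
apply Rabs_le_between in HRe.
pose proof PI_4 as P4. pose proof PI_RGT_0 as P0.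
assert (Hc : 0 < cos y).
{ destruct (Rlt_le_dec 0 (cos y)) as [K|K]; [exact K|]. exfalso. nra. }
assert (Hs : exp x * Rabs (sin y) <= d).
{ replace (exp x * sin y + 0 + - 0) with (exp x * sin y) in HIm by ring.
  rewrite Rabs_mult, (Rabs_pos_eq (exp x)) in HIm by lra. exact HIm. }
assert (Hs' : Rabs (sin y) <= 2 * d).
{ pose proof (Rabs_pos (sin y)). nra. }
assert (Hcc : 0 < cos (Rabs y)).
{ unfold Rabs; destruct (Rcase_abs y); [now rewrite cos_neg|assumption]. }
assert (Hss : sin (Rabs y) <= 2 * d).
{ eapply Rle_trans; [|exact Hs']. unfold Rabs at 1. destruct (Rcase_abs y).
  - rewrite sin_neg, <- Rabs_Ropp. apply Rle_abs.
  - apply Rle_abs. }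
assert (Hy : Rabs y < PI / 2).
{ destruct (Rlt_le_dec (Rabs y) (PI / 2)) as [K|K]; [exact K|]. exfalso.
  assert (cos (Rabs y) <= 0) by (apply cos_le_0; lra). lra. }
pose proof (sin_ge_third (Rabs y) ltac:(split; [apply Rabs_pos|lra])).
eapply Rle_trans; [apply Cmod_le_Re_Im|]. unfold Re, Im; simpl. lra.
Qed.

Definition log_coef (k : nat) : C := RtoC ((- 1) ^ k / INR (S k)).

Definition log_poly (N : nat) (z : C) : C :=
  Csum_n (fun k => log_coef k * z ^ S k)%C N.

(** The derivative is a partial sum of the geometric series of 1 / (1 + z);
multiplied by 1 + z it telescopes, also at the singular point -1. *)
Lemma is_Cderive_log_poly (N : nat) (z : C) :
  exists d, is_Cderive (log_poly N) z d /\ (d * (1 + z) = 1 - (- z) ^ S N)%C.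
Proof.
assert (T : forall k, is_Cderive (fun z => log_coef k * z ^ S k)%C z ((- z) ^ k)).
{ intros k. eapply is_Cderive_eq.
  - apply (is_Cderive_mult (fun _ => log_coef k) (fun z => z ^ S k)%C).
    + apply is_Cderive_const.
    + apply is_Cderive_pow.
  - unfold log_coef. replace (- z)%C with (RtoC (- 1) * z)%C by ring.
    rewrite Cpow_mult_l, <- RtoC_pow, RtoC_div by (apply not_0_INR; discriminate).
    assert (RtoC (INR (S k)) <> 0).
    { intros E. apply RtoC_inj in E. now apply (not_0_INR (S k)). }
    field. assumption. }
induction N as [|N [d [IH E]]].
- exists 1. split.
  + apply (is_Cderive_ext_loc (fun z => log_coef 0 * z ^ 1)%C).
    * apply filter_forall. intros w. unfold log_poly. now rewrite Csum_O.
    * apply (T 0%nat).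
  + simpl. ring.
- exists (d + (- z) ^ S N)%C. split.
  + apply (is_Cderive_ext_loc (fun z => log_poly N z + log_coef (S N) * z ^ S (S N))%C).
    * apply filter_forall. intros w. unfold log_poly. now rewrite Csum_Sn.
    * apply is_Cderive_plus; [exact IH|apply (T (S N))].
  + rewrite Cmult_plus_distr_r, E, (Cpow_S _ (S N)). ring.
Qed.

Lemma log_poly_bound (N : nat) (z : C) :
  Cmod z <= 1 -> Cmod (log_poly N z) <= INR (S N) * Cmod z.
Proof.
intros Hz.
assert (T : forall k, Cmod (log_coef k * z ^ S k) <= Cmod z).
{ intros k. rewrite Cmod_mult, Cmod_pow. unfold log_coef. rewrite Cmod_R.
  unfold Rdiv. rewrite Rabs_mult, pow_1_abs, Rmult_1_l.
  assert (1 <= INR (S k)) by (rewrite S_INR; pose proof (pos_INR k); lra).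
  rewrite Rabs_pos_eq by (apply Rlt_le, Rinv_0_lt_compat; lra).
  rewrite <- (Rmult_1_l (Cmod z)) at 2.
  pose proof (Cmod_ge_0 z).
  apply Rmult_le_compat.
  - apply Rlt_le, Rinv_0_lt_compat; lra.
  - now apply pow_le.
  - rewrite <- Rinv_1. apply Rinv_le_contravar; lra.
  - simpl. assert (Cmod z ^ k <= 1) by (rewrite <- (pow1 k); apply pow_incr; lra). nra. }
unfold log_poly. induction N as [|N IH].
- rewrite Csum_O. eapply Rle_trans; [apply T|]. simpl. lra.
- rewrite Csum_Sn, (S_INR (S N)). eapply Rle_trans; [apply Cmod_triangle|].
  specialize (T (S N)). lra.
Qed.

(** If p is the Taylor polynomial of log (1 + z) of degree N + 1, then
(1 + z) exp (- p z) has derivative exp (- p z) * (- z)^(N + 1), which is small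
near 0. *)
Lemma exp_log_poly (N : nat) (z : C) : Cmod z <= 1 ->
  Cmod ((1 + z) * Cexp (- log_poly N z) - 1) <= exp (INR (S N)) * Cmod z ^ S (S N).
Proof.
intros Hz.
set (q := fun z => ((1 + z) * Cexp (- log_poly N z))%C).
assert (E0 : q 0 = 1).
{ unfold q. replace (log_poly N 0) with (RtoC 0).
  - replace (- 0)%C with (RtoC 0) by ring. rewrite Cexp_0. ring.
  - symmetry. apply Cmod_eq_0. apply Rle_antisym; [|apply Cmod_ge_0].
    eapply Rle_trans; [apply log_poly_bound; rewrite Cmod_0; lra|].
    rewrite Cmod_0. lra. }
change ((1 + z) * Cexp (- log_poly N z))%C with (q z). rewrite <- E0.
replace (exp (INR (S N)) * Cmod z ^ S (S N)) with
  (exp (INR (S N)) * Cmod z ^ S N * Cmod (z - 0)).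
2:{ replace (z - 0)%C with z by ring. simpl. ring. }
apply Cmean_value with (f' := fun z => (Cexp (- log_poly N z) * (- z) ^ S N)%C).
intros t Ht. set (w := (0 + t * (z - 0))%C).
assert (L : Cmod w <= Cmod z).
{ unfold w. replace (0 + t * (z - 0))%C with (RtoC t * z)%C by ring.
  rewrite Cmod_mult, Cmod_R, Rabs_pos_eq by lra. pose proof (Cmod_ge_0 z). nra. }
clearbody w. split.
- destruct (is_Cderive_log_poly N w) as [d [Hd E]].
  eapply is_Cderive_eq.
  + apply (is_Cderive_mult (fun z => 1 + z)%C (fun z => Cexp (- log_poly N z))%C).
    * apply (is_Cderive_plus (fun _ => RtoC 1) (fun z => z)); [apply is_Cderive_const|apply is_Cderive_id].
    * apply (is_Cderive_comp Cexp (fun z => - log_poly N z)%C); [apply is_Cderive_Cexp|].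
      apply (is_Cderive_ext_loc (fun z => 0 - log_poly N z)%C).
      -- apply filter_forall. intros x. change (0 - log_poly N x = - log_poly N x)%C. ring.
      -- apply (is_Cderive_minus (fun _ => RtoC 0)); [apply is_Cderive_const|exact Hd].
  + cbv beta. transitivity (Cexp (- log_poly N w) * (1 - d * (1 + w)))%C; [ring|].
    rewrite E. ring.
- rewrite Cmod_mult, Cmod_pow, Cmod_opp.
  apply Rmult_le_compat; try apply Cmod_ge_0.
  + apply pow_le, Cmod_ge_0.
  + eapply Rle_trans; [apply Cmod_Cexp_le|]. rewrite Cmod_opp.
    assert (K : Cmod (log_poly N w) <= INR (S N)).
    { eapply Rle_trans; [apply log_poly_bound; lra|].
      pose proof (pos_INR (S N)). nra. }
    destruct K as [K|K]; [now apply Rlt_le, exp_increasing|rewrite K; lra].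
  + apply pow_incr. split; [apply Cmod_ge_0|exact L].
Qed.

(** By [exp_log_poly], the exponential of l - p z is 1 + O(z^(N + 2)).  Both l and
p z are small, hence so is the imaginary part of their difference, and
[log_near_one] bounds that difference. *)
Lemma log_expansion (N : nat) : exists r K, 0 < r /\ 0 <= K /\ forall z l : C,
  Cmod z <= r -> is_principal_log (1 + z) l ->
  Cmod (l - log_poly N z) <= K * Cmod z ^ S (S N).
Proof.
set (A := exp (INR (S N))).
assert (HA : 1 <= A).
{ unfold A. pose proof (exp_ineq1_le (INR (S N))). pose proof (pos_INR (S N)). lra. }
assert (HN : 0 <= INR (S N)) by apply pos_INR.
(* The summands of B serve the two uses of [log_near_one]: 2 * A makes the bound
   on |exp (l - p z) - 1| at most 1/2, and 8 + INR (S N) makes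
   |l| + |p z| at most 1. *)
set (B := 2 * A + 8 + INR (S N)).
assert (HB : 0 < B) by (unfold B; lra).
exists (/ B), (8 * A).
split; [now apply Rinv_0_lt_compat|]. split; [lra|].
intros z l Hz [E HI].
pose proof (Cmod_ge_0 z) as Z0.
assert (HzB : B * Cmod z <= 1).
{ apply (Rmult_le_compat_l B) in Hz; [|lra]. rewrite Rinv_r in Hz; lra. }
assert (Z1 : Cmod z <= 1 /\ 2 * A * Cmod z <= 1 /\ (8 + INR (S N)) * Cmod z <= 1).
{ unfold B in HzB. pose proof (Rmult_le_pos _ _ HN Z0). nra. }
destruct Z1 as [Z1 [Z2 Z3]].
assert (Hl : Cmod l <= 8 * Cmod z).
{ apply log_near_one.
  - rewrite E. replace (1 + z - 1)%C with z by ring. lra.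
  - nra.
  - apply Rabs_le. lra. }
assert (Hp := log_poly_bound N z Z1).
rewrite Rmult_assoc. apply log_near_one.
- unfold Cminus. rewrite Cexp_plus, E. apply (exp_log_poly N z Z1).
- fold A. apply Rle_trans with (A * Cmod z); [|nra].
  apply Rmult_le_compat_l; [lra|]. simpl.
  assert (Cmod z ^ N <= 1) by (rewrite <- (pow1 N); apply pow_incr; lra).
  assert (0 <= Cmod z ^ N) by now apply pow_le.
  assert (Cmod z * Cmod z ^ N <= 1) by nra. nra.
- eapply Rle_trans; [apply Im_Cmod_le|]. eapply Rle_trans; [apply Cmod_triangle|].
  rewrite Cmod_opp. pose proof PI2_1. lra.
Qed.

(** * Poles and meromorphic functions *)

Lemma is_Cderive_inv (z : C) : z <> 0 -> is_Cderive Cinv z (- / (z * z)).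
Proof.
intros Hz. apply is_Cderive_eps. intros eps He.
assert (M : 0 < Cmod z) by now apply Cmod_gt_0.
assert (M3 : 0 < Cmod z * (Cmod z * Cmod z)) by (repeat apply Rmult_lt_0_compat; exact M).
exists (Rmin (Cmod z / 2) (eps * (Cmod z * (Cmod z * Cmod z)) / 2)).
split; [apply Rmin_glb_lt; nra|].
intros w Hw. apply Rmin_Rgt in Hw as [W1 W2].
assert (Mw : Cmod z / 2 <= Cmod w).
{ assert (T := Cmod_triangle w (z - w)). replace (w + (z - w))%C with z in T by ring.
  replace (z - w)%C with (- (w - z))%C in T by ring. rewrite Cmod_opp in T. lra. }
assert (Hw0 : w <> 0) by (apply Cmod_gt_0; lra).
replace (/ w - / z - (w - z) * - / (z * z))%C with ((w - z) * (w - z) / (w * (z * z)))%C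
  by (field; now split).
rewrite Cmod_div, !Cmod_mult by (repeat apply Cmult_neq_0; assumption).
set (u := Cmod (w - z)) in *. assert (0 <= u) by apply Cmod_ge_0.
apply Rmult_le_reg_r with (Cmod w * (Cmod z * Cmod z)); [nra|].
unfold Rdiv. rewrite Rmult_assoc, Rinv_l by nra. rewrite Rmult_1_r.
replace (eps * u * (Cmod w * (Cmod z * Cmod z))) with (u * (eps * (Cmod w * (Cmod z * Cmod z)))) by ring.
apply Rmult_le_compat_l; [assumption|].
apply Rle_trans with (eps * (Cmod z / 2 * (Cmod z * Cmod z))); [lra|].
apply Rmult_le_compat_l; [lra|]. apply Rmult_le_compat_r; [nra|exact Mw].
Qed.

Lemma holomorphic_at_mult (f g : C -> C) (z : C) :
  holomorphic_at f z -> holomorphic_at g z -> holomorphic_at (fun w => f w * g w)%C z.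
Proof. intros [df Hf] [dg Hg]. eexists. exact (is_Cderive_mult f g z df dg Hf Hg). Qed.

Lemma holomorphic_at_plus (f g : C -> C) (z : C) :
  holomorphic_at f z -> holomorphic_at g z -> holomorphic_at (fun w => f w + g w)%C z.
Proof. intros [df Hf] [dg Hg]. eexists. exact (is_Cderive_plus f g z df dg Hf Hg). Qed.

Lemma holomorphic_at_const (a z : C) : holomorphic_at (fun _ => a) z.
Proof. eexists. exact (is_Cderive_const a z). Qed.

Lemma holomorphic_at_id (z : C) : holomorphic_at (fun w => w) z.
Proof. eexists. exact (is_Cderive_id z). Qed.

Lemma holomorphic_at_comp (f g : C -> C) (z : C) :
  holomorphic_at f (g z) -> holomorphic_at g z -> holomorphic_at (fun w => f (g w)) z.
Proof. intros [df Hf] [dg Hg]. eexists. exact (is_Cderive_comp f g z df dg Hf Hg). Qed.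

Lemma holomorphic_at_ext_loc (f g : C -> C) (z : C) :
  locally z (fun w => f w = g w) -> holomorphic_at f z -> holomorphic_at g z.
Proof. intros E [df Hf]. eexists. exact (is_Cderive_ext_loc f g z df E Hf). Qed.

Lemma holomorphic_at_affine (s t z : C) : holomorphic_at (fun w => s * w + t)%C z.
Proof.
apply holomorphic_at_plus; [|apply holomorphic_at_const].
apply holomorphic_at_mult; [apply holomorphic_at_const|apply holomorphic_at_id].
Qed.

Lemma holomorphic_at_pow (p : C) (m : nat) (z : C) :
  holomorphic_at (fun w => (w - p) ^ m)%C z.
Proof.
destruct m as [|m]; [exact (holomorphic_at_const 1 z)|].
apply (holomorphic_at_comp (fun w => w ^ S m)%C (fun w => w - p)%C).
- eexists. exact (is_Cderive_pow m _).
- apply holomorphic_at_plus; [apply holomorphic_at_id|apply holomorphic_at_const].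
Qed.

Lemma punctured_Cmod (p : C) (P : C -> Prop) :
  locally' p P <-> exists r, 0 < r /\ forall w, w <> p -> Cmod (w - p) < r -> P w.
Proof.
unfold locally', within. rewrite locally_Cmod.
split; intros [r [Hr H]]; exists r; (split; [exact Hr|]); intros w; auto.
Qed.

Lemma Cminus_neq_0 (z w : C) : z <> w -> (z - w)%C <> 0.
Proof. intros H E. apply H. replace z with (z - w + w)%C by ring. rewrite E. ring. Qed.

(** A punctured neighbourhood is open. *)
Lemma locally_punctured (p : C) (P : C -> Prop) :
  locally' p P -> locally' p (fun z => locally z P).
Proof.
rewrite !punctured_Cmod. intros [r [Hr H]]. exists r. split; [exact Hr|].
intros w Hw Hwr. apply locally_Cmod.
exists (Rmin (Cmod (w - p)) (r - Cmod (w - p))). split.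
- apply Rmin_glb_lt; [|lra]. now apply Cmod_gt_0, Cminus_neq_0.
- intros v Hv. apply Rmin_Rgt in Hv as [V1 V2]. apply H.
  + intros ->. replace (p - w)%C with (- (w - p))%C in V1 by ring.
    rewrite Cmod_opp in V1. lra.
  + replace (v - p)%C with ((v - w) + (w - p))%C by ring.
    eapply Rle_lt_trans; [apply Cmod_triangle|]. lra.
Qed.

Lemma at_most_pole_holomorphic (g : C -> C) (p : C) :
  at_most_pole g p -> locally' p (holomorphic_at g).
Proof.
intros [m [phi [Hphi Hg]]].
assert (H1 : locally' p (holomorphic_at phi)).
{ apply locally_Cmod in Hphi as [r [Hr H]]. apply punctured_Cmod.
  exists r; split; [exact Hr|]. intros w _. apply H. }
assert (H2 := locally_punctured _ _ Hg).
assert (H3 : locally' p (fun z => z <> p)).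
{ apply punctured_Cmod. exists 1. split; [lra|auto]. }
generalize (filter_and _ _ H1 (filter_and _ _ H2 H3)).
apply filter_imp. intros z [K1 [K2 K3]].
apply (holomorphic_at_ext_loc (fun z => phi z * / (z - p) ^ m)%C).
- generalize K2. apply filter_imp. intros w ->. reflexivity.
- apply holomorphic_at_mult; [exact K1|].
  apply (holomorphic_at_comp Cinv (fun z => (z - p) ^ m)%C).
  + eexists. apply is_Cderive_inv. now apply Cpow_nz, Cminus_neq_0.
  + apply holomorphic_at_pow.
Qed.

Lemma at_most_pole_of_holomorphic (g : C -> C) (p : C) :
  locally p (holomorphic_at g) -> at_most_pole g p.
Proof.
intros H. exists 0%nat, g. split; [exact H|].
apply punctured_Cmod. exists 1. split; [lra|]. intros w _ _. simpl. field.
Qed.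

(** A function with at most a pole at p is holomorphic in a punctured
neighbourhood of p; so if this holds everywhere, the points at which it is not
holomorphic are isolated and may serve as the singular set.  This makes
meromorphy a local property. *)
Lemma meromorphic_iff (g : C -> C) :
  meromorphic g <-> forall p, at_most_pole g p.
Proof.
split.
- intros [S [Hd [Hh Hp]]] p. destruct (classic (S p)) as [H|H]; [now apply Hp|].
  apply at_most_pole_of_holomorphic.
  destruct (proj1 (punctured_Cmod _ _) (Hd p)) as [r [Hr Hw]].
  apply locally_Cmod. exists r. split; [exact Hr|]. intros w Hwr. apply Hh.
  destruct (classic (w = p)) as [->|E]; [exact H|now apply Hw].
- intros H. exists (fun z => ~ holomorphic_at g z). split; [|split].
  + intros z. generalize (at_most_pole_holomorphic g z (H z)).
    apply filter_imp. auto.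
  + intros z. apply NNPP.
  + intros p _. apply H.
Qed.

(** Being local, the property passes to functions that are chosen piecewise. *)
Lemma at_most_pole_ext (f g : C -> C) (p : C) :
  locally' p (fun z => f z = g z) -> at_most_pole f p -> at_most_pole g p.
Proof.
intros E [m [phi [H1 H2]]]. exists m, phi. split; [exact H1|].
generalize (filter_and _ _ E H2). apply filter_imp. now intros z [<- K].
Qed.

Lemma at_most_pole_plus (f g : C -> C) (p : C) :
  at_most_pole f p -> at_most_pole g p -> at_most_pole (fun z => f z + g z)%C p.
Proof.
intros [m [phi [H1 H2]]] [n [psi [K1 K2]]].
exists (m + n)%nat, (fun z => phi z * (z - p) ^ n + psi z * (z - p) ^ m)%C. split.
- generalize (filter_and _ _ H1 K1). apply filter_imp. intros z [A B].
  apply holomorphic_at_plus; apply holomorphic_at_mult; auto using holomorphic_at_pow.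
- generalize (filter_and _ _ H2 K2). unfold locally', within. apply filter_imp. intros z HH Hz.
  destruct (HH Hz) as [-> ->]. rewrite Cpow_add_r.
  apply Cminus_neq_0 in Hz. field. split; now apply Cpow_nz.
Qed.

Lemma at_most_pole_mult (e g : C -> C) (p : C) :
  (forall z, holomorphic_at e z) -> at_most_pole g p -> at_most_pole (fun z => e z * g z)%C p.
Proof.
intros He [m [phi [H1 H2]]]. exists m, (fun z => e z * phi z)%C. split.
- generalize H1. apply filter_imp. intros z A. now apply holomorphic_at_mult.
- generalize H2. unfold locally', within. apply filter_imp. intros z HH Hz.
  rewrite (HH Hz). apply Cminus_neq_0 in Hz. field. now apply Cpow_nz.
Qed.

Lemma at_most_pole_affine (g : C -> C) (s t p : C) : s <> 0 ->
  at_most_pole g (s * p + t) -> at_most_pole (fun z => g (s * z + t)%C) p.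
Proof.
intros Hs [m [phi [H1 H2]]].
assert (M : 0 < Cmod s) by now apply Cmod_gt_0.
exists m, (fun z => / s ^ m * phi (s * z + t))%C.
assert (E : forall w, (s * w + t - (s * p + t) = s * (w - p))%C) by (intros; ring).
assert (D : forall r w, Cmod (w - p) < r / Cmod s -> Cmod (s * w + t - (s * p + t)) < r).
{ intros r w Hw. rewrite E, Cmod_mult.
  apply (Rmult_lt_compat_l (Cmod s)) in Hw; [|exact M].
  now replace (Cmod s * (r / Cmod s)) with r in Hw by (field; lra). }
split.
- apply locally_Cmod in H1 as [r [Hr H1]]. apply locally_Cmod.
  exists (r / Cmod s). split; [now apply Rdiv_lt_0_compat|]. intros w Hw.
  apply holomorphic_at_mult; [apply holomorphic_at_const|].
  apply (holomorphic_at_comp phi (fun z => s * z + t)%C); [apply H1, D, Hw|].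
  apply holomorphic_at_affine.
- apply punctured_Cmod in H2 as [r [Hr H2]]. apply punctured_Cmod.
  exists (r / Cmod s). split; [now apply Rdiv_lt_0_compat|]. intros w Hw Hwr.
  assert (Hn := Cminus_neq_0 _ _ Hw).
  rewrite H2.
  + rewrite E, Cpow_mult_l. field. split; now apply Cpow_nz.
  + intros K. apply (Cmult_neq_0 s (w - p)); auto. rewrite <- E, K. ring.
  + apply D, Hwr.
Qed.

(** * Series of holomorphic functions and gluing *)

Local Notation is_Cseries := (@is_series C_AbsRing C_NormedModule) (only parsing).

Lemma ex_series_R_le (a b : nat -> R) :
  eventually (fun n => Rabs (a n) <= b n) -> ex_series b -> ex_series a.
Proof.
intros [n0 H] Hb. apply (ex_series_incr_n a n0). apply ex_series_incr_n with (n := n0) in Hb.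
apply (ex_series_le (V := R_CompleteNormedModule)) with (2 := Hb). intros n. apply H. lia.
Qed.

Lemma ex_Cseries_le (a : nat -> C) (b : nat -> R) :
  eventually (fun n => Cmod (a n) <= b n) -> ex_series b -> exists l, is_Cseries a l.
Proof.
intros [n0 H] Hb.
apply (ex_series_incr_n (V := C_NormedModule) a n0).
apply (ex_series_incr_n b n0) in Hb.
apply (ex_series_le (V := C_CompleteNormedModule)) with (2 := Hb).
intros n. apply H. lia.
Qed.

Lemma is_Cseries_eps (a : nat -> C) (l : C) : is_Cseries a l ->
  forall eps, 0 < eps -> eventually (fun n => Cmod (Csum_n a n - l) < eps).
Proof.
intros H eps He. apply (H (fun z => Cmod (z - l) < eps)).
apply locally_Cmod. exists eps. auto.
Qed.

Lemma is_series_eps (a : nat -> R) (l : R) : is_series a l ->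
  forall eps, 0 < eps -> eventually (fun n => Rabs (sum_n a n - l) < eps).
Proof.
intros H eps He. apply (H (fun z => Rabs (z - l) < eps)).
exists (mkposreal eps He). auto.
Qed.

Lemma Cmod_series_le (a : nat -> C) (b : nat -> R) (l : C) (m : R) :
  is_Cseries a l -> is_series b m -> (forall n, Cmod (a n) <= b n) -> Cmod l <= m.
Proof.
intros Ha Hb H. apply le_epsilon. intros eps He.
assert (He2 : 0 < eps / 2) by lra.
destruct (filter_and _ _ (is_Cseries_eps a l Ha (eps / 2) He2)
                         (is_series_eps b m Hb (eps / 2) He2)) as [n Hn].
destruct (Hn n (le_n n)) as [H1 H2].
assert (T : Cmod (Csum_n a n) <= sum_n b n).
{ clear -H. induction n as [|n IH].
  - rewrite Csum_O, sum_O. apply H.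
  - rewrite Csum_Sn, sum_Sn. eapply Rle_trans; [apply Cmod_triangle|].
    apply Rplus_le_compat; auto. }
apply Rabs_def2 in H2.
replace l with (- (Csum_n a n - l) + Csum_n a n)%C by ring.
eapply Rle_trans; [apply Cmod_triangle|]. rewrite Cmod_opp. lra.
Qed.

Lemma is_Cseries_tail (a : nat -> C) (l : C) (K : nat) :
  is_Cseries a l -> is_Cseries (fun n => a (S K + n)%nat) (l - Csum_n a K)%C.
Proof.
intros H. apply (is_series_incr_n (V := C_NormedModule) a (S K)); [lia|].
change (is_Cseries a (l - Csum_n a K + Csum_n a K)%C).
now replace (l - Csum_n a K + Csum_n a K)%C with l by ring.
Qed.

Lemma is_series_tail (a : nat -> R) (l : R) (K : nat) :
  is_series a l -> is_series (fun n => a (S K + n)%nat) (l - sum_n a K).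
Proof.
intros H. apply (is_series_incr_n a (S K)); [lia|].
change (is_series a (l - sum_n a K + sum_n a K)).
now replace (l - sum_n a K + sum_n a K) with l by ring.
Qed.

Lemma is_Cseries_plus (a b : nat -> C) (la lb : C) :
  is_Cseries a la -> is_Cseries b lb -> is_Cseries (fun n => a n + b n)%C (la + lb)%C.
Proof. exact (is_series_plus (V := C_NormedModule) a b la lb). Qed.

Lemma is_Cseries_minus (a b : nat -> C) (la lb : C) :
  is_Cseries a la -> is_Cseries b lb -> is_Cseries (fun n => a n - b n)%C (la - lb)%C.
Proof. exact (is_series_minus (V := C_NormedModule) a b la lb). Qed.

Lemma is_Cseries_scal (k : C) (a : nat -> C) (la : C) :
  is_Cseries a la -> is_Cseries (fun n => k * a n)%C (k * la)%C.
Proof. exact (is_series_scal (V := C_NormedModule) k a la). Qed.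

Lemma is_Cseries_ext (a b : nat -> C) (l : C) :
  (forall n, a n = b n) -> is_Cseries a l -> is_Cseries b l.
Proof. exact (is_series_ext (V := C_NormedModule) a b l). Qed.

Lemma is_Cseries_unique (a : nat -> C) (l l' : C) :
  is_Cseries a l -> is_Cseries a l' -> l = l'.
Proof.
intros H H'. apply (filterlim_locally_unique (V := C_NormedModule) _ _ _ H H').
Qed.

Lemma is_Cderive_sum (f : nat -> C -> C) (d : nat -> C) (K : nat) (z : C) :
  (forall n, is_Cderive (f n) z (d n)) ->
  is_Cderive (fun w => Csum_n (fun n => f n w) K) z (Csum_n d K).
Proof.
intros H.
exact (is_derive_sum_n (K := C_AbsRing) (V := C_NormedModule) f K z d (fun k _ => H k)).
Qed.

(** Termwise differentiation by dominated derivatives.  The difference quotient of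
the sum is compared with that of a partial sum; the tail is Lipschitz at s0, by
the mean value inequality, with a constant that is a tail of the series of B. *)
Lemma series_holomorphic (f f' : nat -> C -> C) (F : C -> C) (B : nat -> R) (s0 : C) (r : R) :
  0 < r ->
  (forall n s, Cmod (s - s0) < r -> is_Cderive (f n) s (f' n s)) ->
  eventually (fun n => forall s, Cmod (s - s0) < r -> Cmod (f' n s) <= B n) ->
  ex_series B ->
  (forall s, Cmod (s - s0) < r -> is_Cseries (fun n => f n s) (F s)) ->
  holomorphic_at F s0.
Proof.
intros Hr Hd HB [b Hb] HF.
assert (Z : Cmod (s0 - s0) < r).
{ replace (s0 - s0)%C with (RtoC 0) by ring. now rewrite Cmod_0. }
destruct (ex_Cseries_le (fun n => f' n s0) B) as [d Hdd].
{ generalize HB. apply filter_imp. auto. }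
{ now exists b. }
exists d. apply is_Cderive_eps. intros eps He.
assert (He3 : 0 < eps / 3) by lra.
destruct (filter_and _ _ HB (filter_and _ _
   (is_Cseries_eps _ _ Hdd (eps / 3) He3)
   (is_series_eps _ _ Hb (eps / 3) He3))) as [K HK].
assert (HBK : forall n, (K <= n)%nat -> forall s, Cmod (s - s0) < r -> Cmod (f' n s) <= B n).
{ intros n Hn. apply (HK n Hn). }
destruct (HK K (le_n K)) as [_ [HK1 HK2]].
assert (HP := is_Cderive_sum f (fun n => f' n s0) K s0 (fun n => Hd n s0 Z)).
rewrite is_Cderive_eps in HP. destruct (HP (eps / 3) He3) as [r1 [Hr1 HP1]].
exists (Rmin r r1). split; [now apply Rmin_glb_lt|].
intros s Hs. apply Rmin_Rgt in Hs as [Hs Hs1].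
specialize (HP1 s Hs1). clear HP HK.
set (P := fun s => Csum_n (fun n => f n s) K) in *.
set (Q := Csum_n (fun n => f' n s0) K) in *.
change (Cmod (P s - P s0 - (s - s0) * Q) <= eps / 3 * Cmod (s - s0)) in HP1.
assert (HT : Cmod ((F s - P s) - (F s0 - P s0)) <= (b - sum_n B K) * Cmod (s - s0)).
{ apply Cmod_series_le with
   (a := fun n => (f (S K + n)%nat s - f (S K + n)%nat s0)%C)
   (b := fun n => B (S K + n)%nat * Cmod (s - s0)).
  - apply is_Cseries_minus.
    + apply (is_Cseries_tail (fun n => f n s) (F s) K), HF, Hs.
    + apply (is_Cseries_tail (fun n => f n s0) (F s0) K), HF, Z.
  - apply is_series_scal_r. now apply is_series_tail.
  - intros n. apply Cmean_value with (f' := f' (S K + n)%nat).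
    intros t Ht.
    assert (L : Cmod (s0 + t * (s - s0) - s0) < r).
    { replace (s0 + t * (s - s0) - s0)%C with (RtoC t * (s - s0))%C by ring.
      rewrite Cmod_mult, Cmod_R, Rabs_pos_eq by lra. pose proof (Cmod_ge_0 (s - s0)). nra. }
    split; [now apply Hd|]. apply HBK; [lia|exact L]. }
replace (F s - F s0 - (s - s0) * d)%C with
  ((P s - P s0 - (s - s0) * Q) + ((F s - P s) - (F s0 - P s0)) + (s - s0) * (Q - d))%C by ring.
pose proof (Cmod_ge_0 (s - s0)) as G.
apply Rabs_def2 in HK2.
eapply Rle_trans; [apply Cmod_triangle|].
eapply Rle_trans; [apply Rplus_le_compat_r, Cmod_triangle|].
rewrite (Cmod_mult (s - s0) (Q - d)).
assert (HQ : Cmod (s - s0) * Cmod (Q - d) <= Cmod (s - s0) * (eps / 3)).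
{ apply Rmult_le_compat_l; [exact G|]. apply Rlt_le, HK1. }
assert (HB' : (b - sum_n B K) * Cmod (s - s0) <= eps / 3 * Cmod (s - s0)).
{ apply Rmult_le_compat_r; [exact G|]. lra. }
lra.
Qed.

(** The function G_N = T_0 + ... + T_N + H_N is meromorphic to the right of
x_(N+1) and does not change there when N grows.  The extension takes at s the
value of any G_N with x_(N+1) to the left of s.  To the right of x_0, the series
of the t_0 has sum T_0, and G_0 is the sum of the series of the v_n. *)
Lemma glue (v : nat -> C -> C) (t : nat -> nat -> C -> C) (T H : nat -> C -> C) (x : nat -> R) :
  (forall k, x (S k) <= x k) ->
  is_lim_seq x m_infty ->
  (forall k, meromorphic (T k)) ->
  (forall k s, half_plane (x k) s -> is_Cseries (fun n => t k n s) (T k s)) ->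
  (forall N s, half_plane (x (S N)) s ->
     is_Cseries (fun n => v n s - Csum_n (fun k => t k n s) N)%C (H N s)) ->
  (forall N s, half_plane (x (S N)) s -> holomorphic_at (H N) s) ->
  extends_meromorphically (half_plane (x 0%nat)) v.
Proof.
intros Hx Hlim HT Ht HH Hhol.
set (G := fun N s => (Csum_n (fun k => T k s) N + H N s)%C).
assert (G1 : forall N s, half_plane (x (S N)) s -> G (S N) s = G N s).
{ intros N s Hs. unfold G. rewrite Csum_Sn.
  assert (E : H (S N) s = (H N s - T (S N) s)%C).
  { apply (is_Cseries_unique (fun n => v n s - Csum_n (fun k => t k n s) (S N))%C).
    - apply HH. unfold half_plane in *. specialize (Hx (S N)). lra.
    - apply (is_Cseries_ext (fun n => v n s - Csum_n (fun k => t k n s) N - t (S N) n s)%C).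
      + intros n. rewrite Csum_Sn. ring.
      + apply is_Cseries_minus; auto. }
  rewrite E. ring. }
assert (Hxle : forall N k, (N <= k)%nat -> x k <= x N).
{ intros N k Hk. induction Hk as [|k Hk IH]; [lra|]. specialize (Hx k). lra. }
assert (G2 : forall N k s, (N <= k)%nat -> half_plane (x (S N)) s -> G k s = G N s).
{ intros N k s Hk Hs. induction Hk as [|k Hk IH]; [reflexivity|].
  rewrite <- IH. apply G1. unfold half_plane in *.
  specialize (Hxle (S N) (S k) ltac:(lia)). lra. }
(* The margin 1 makes the choice at s valid on the unit disc around s. *)
assert (HN : forall s, exists N, x (S N) < Re s - 1).
{ intros s. destruct (Hlim (fun y => y < Re s - 1)) as [N K].
  - exists (Re s - 1). auto.
  - exists N. apply K. lia. }
destruct (functional_choice _ HN) as [N HNs]. clear HN.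
exists (fun s => G (N s) s). split.
- apply meromorphic_iff. intros p.
  apply (at_most_pole_ext (G (N p))).
  + apply punctured_Cmod. exists 1. split; [lra|]. intros w _ Hw.
    assert (Hre : half_plane (x (S (N p))) w).
    { unfold half_plane. specialize (HNs p).
      pose proof (Rle_trans _ _ _ (Re_Cmod_le (w - p)) (Rlt_le _ _ Hw)) as K.
      apply Rabs_le_between in K. unfold Re in *; simpl in K. lra. }
    assert (Hre' : half_plane (x (S (N w))) w).
    { unfold half_plane. specialize (HNs w). lra. }
    destruct (Nat.le_ge_cases (N p) (N w)) as [L|L].
    * symmetry. now apply G2.
    * now apply G2.
  + apply at_most_pole_plus.
    * generalize (N p) as M. intros M. induction M as [|M IH].
      -- apply (at_most_pole_ext (T 0%nat)).
         ++ apply filter_forall. intros w. now rewrite Csum_O.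
         ++ now apply meromorphic_iff.
      -- apply (at_most_pole_ext (fun s => Csum_n (fun k => T k s) M + T (S M) s)%C).
         ++ apply filter_forall. intros w. now rewrite Csum_Sn.
         ++ apply at_most_pole_plus; [exact IH|now apply meromorphic_iff].
    * apply at_most_pole_of_holomorphic, locally_Cmod.
      exists 1. split; [lra|]. intros w Hw. apply Hhol.
      unfold half_plane. specialize (HNs p).
      pose proof (Rle_trans _ _ _ (Re_Cmod_le (w - p)) (Rlt_le _ _ Hw)) as K.
      apply Rabs_le_between in K. unfold Re in *; simpl in K. lra.
- intros s Hs.
  assert (H1 : half_plane (x 1%nat) s).
  { unfold half_plane in *. specialize (Hx 0%nat). lra. }
  rewrite (G2 0%nat (N s) s ltac:(lia) H1). unfold G. rewrite Csum_O.
  apply (is_Cseries_ext (fun n => t 0%nat n s + (v n s - Csum_n (fun k => t k n s) 0))%C).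
  + intros n. rewrite Csum_O. ring.
  + apply is_Cseries_plus; auto.
Qed.

(** * Dirichlet series and multipliers *)

Lemma exp_le (x y : R) : x <= y -> exp x <= exp y.
Proof. intros [H| ->]; [now apply Rlt_le, exp_increasing|lra]. Qed.

Lemma Cmod_pos_cpow (c : R) (s : C) : Cmod (pos_cpow c s) = exp (Re s * ln c).
Proof.
unfold pos_cpow. rewrite Cmod_Cexp. f_equal. destruct s; unfold Re; simpl. ring.
Qed.

Lemma pos_cpow_plus (c : R) (s t : C) : pos_cpow c (s + t) = (pos_cpow c s * pos_cpow c t)%C.
Proof. unfold pos_cpow. rewrite <- Cexp_plus. f_equal. ring. Qed.

Lemma Cexp_RtoC (x : R) : Cexp (RtoC x) = RtoC (exp x).
Proof.
unfold Cexp, Re, Im; simpl. rewrite cos_0, sin_0. unfold Cmult, RtoC; simpl. f_equal; ring.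
Qed.

Lemma pos_cpow_RtoC (c y : R) : pos_cpow c (RtoC y) = RtoC (exp (y * ln c)).
Proof. unfold pos_cpow. rewrite <- RtoC_mult. apply Cexp_RtoC. Qed.

Lemma is_Cderive_pos_cpow (c : R) (k s : C) :
  is_Cderive (fun s => pos_cpow c (k * s)) s (k * RtoC (ln c) * pos_cpow c (k * s)).
Proof.
unfold pos_cpow. eapply is_Cderive_eq.
- apply (is_Cderive_comp Cexp (fun s => k * s * RtoC (ln c))%C).
  + apply is_Cderive_Cexp.
  + apply (is_Cderive_mult (fun s => k * s)%C (fun _ => RtoC (ln c))); [|apply is_Cderive_const].
    apply (is_Cderive_mult (fun _ => k) (fun s => s)); [apply is_Cderive_const|apply is_Cderive_id].
- cbv beta. ring.
Qed.

Lemma ln_eventually (c : nat -> R) (M : R) :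
  (forall n, 0 < c n) -> is_lim_seq c 0 -> eventually (fun n => ln (c n) <= M).
Proof.
intros Hc Hl. assert (He := exp_pos M).
destruct (Hl (fun y => Rabs (y - 0) < exp M)) as [N HN].
{ exists (mkposreal _ He). auto. }
exists N. intros n Hn. specialize (HN n Hn). rewrite Rminus_0_r in HN.
apply Rabs_def2 in HN. rewrite <- (ln_exp M).
apply Rlt_le, ln_increasing; [apply Hc|lra].
Qed.

(** Differentiating c_n^(sigma s) produces a factor log c_n.  Since c_n tends to
0, this factor is O(c_n^(- d)) for each d > 0, which is absorbed because the
condition on s is an open one. *)
Lemma dirichlet_holomorphic (c : nat -> R) (sigma : R) (phi phi' : nat -> C -> C)
    (omega : nat -> R) (X : R) :
  (forall n, 0 < c n) -> is_lim_seq c 0 -> 0 < sigma ->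
  (forall n, 0 <= omega n) ->
  (forall x, X < x -> ex_series (fun n => omega n * exp (x * ln (c n)))) ->
  (forall n s, is_Cderive (phi n) s (phi' n s)) ->
  (forall K, 0 <= K -> exists B, 0 <= B /\ eventually (fun n => forall s, Cmod s <= K ->
      Cmod (phi n s) <= B * omega n /\ Cmod (phi' n s) <= B * omega n)) ->
  exists F, forall s, X < sigma * Re s ->
    is_Cseries (fun n => pos_cpow (c n) (RtoC sigma * s) * phi n s)%C (F s) /\
    holomorphic_at F s.
Proof.
intros Hc Hl Hs Hw Hconv Hphi Hbound.
assert (Hre : forall s : C, Re (RtoC sigma * s) = sigma * Re s).
{ intros s. unfold Re; simpl. ring. }
assert (Hex : forall s, exists l, X < sigma * Re s ->
   is_Cseries (fun n => pos_cpow (c n) (RtoC sigma * s) * phi n s)%C l).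
{ intros s. destruct (Rlt_dec X (sigma * Re s)) as [Hx|Hx]; [|exists (RtoC 0); now intros].
  destruct (Hbound (Cmod s) (Cmod_ge_0 s)) as [B [HB HB']].
  destruct (ex_Cseries_le (fun n => pos_cpow (c n) (RtoC sigma * s) * phi n s)%C
    (fun n => B * (omega n * exp (sigma * Re s * ln (c n))))) as [l H].
  - generalize HB'. apply filter_imp. intros n Hn.
    rewrite Cmod_mult, Cmod_pos_cpow, Hre.
    replace (B * (omega n * exp (sigma * Re s * ln (c n)))) with
      (exp (sigma * Re s * ln (c n)) * (B * omega n)) by ring.
    apply Rmult_le_compat_l; [apply Rlt_le, exp_pos|].
    apply (Hn s). lra.
  - apply (ex_series_scal_l (K := R_AbsRing) (V := R_NormedModule) B). now apply Hconv.
  - now exists l. }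
destruct (functional_choice _ Hex) as [F HF]. exists F.
intros s0 H0. split; [now apply HF|].
(* One d pays for the radius of the ball, one for log c_n, and one remains for
   the strict inequality. *)
set (d := (sigma * Re s0 - X) / 3). assert (Hd : 0 < d) by (unfold d; lra).
set (r := d / sigma). assert (Hr : 0 < r) by now apply Rdiv_lt_0_compat.
assert (Hball : forall s, Cmod (s - s0) < r -> sigma * Re s0 - d <= sigma * Re s).
{ intros s H. pose proof (Rle_trans _ _ _ (Re_Cmod_le (s - s0)) (Rlt_le _ _ H)) as K.
  apply Rabs_le_between in K. replace (Re (s - s0)) with (Re s - Re s0) in K
   by (unfold Re; simpl; ring).
  assert (sigma * (Re s0 - Re s) <= sigma * r) by (apply Rmult_le_compat_l; lra).
  replace (sigma * r) with d in * by (unfold r; field; lra). lra. }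
destruct (Hbound (Cmod s0 + r)) as [B [HB HB']].
{ pose proof (Cmod_ge_0 s0). lra. }
apply (series_holomorphic
  (fun n s => pos_cpow (c n) (RtoC sigma * s) * phi n s)%C
  (fun n s => RtoC sigma * RtoC (ln (c n)) * pos_cpow (c n) (RtoC sigma * s) * phi n s +
              pos_cpow (c n) (RtoC sigma * s) * phi' n s)%C F
  (fun n => (sigma / d + 1) * B * (omega n * exp ((sigma * Re s0 - 2 * d) * ln (c n)))) s0 r Hr).
- intros n s _. apply (is_Cderive_mult (fun s => pos_cpow (c n) (RtoC sigma * s)) (phi n)).
  + apply is_Cderive_pos_cpow.
  + apply Hphi.
- generalize (filter_and _ _ HB' (ln_eventually c 0 Hc Hl)). apply filter_imp.
  intros n [Hn Hln] s H.
  assert (Ks : Cmod s <= Cmod s0 + r).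
  { replace s with (s0 + (s - s0))%C by ring.
    eapply Rle_trans; [apply Cmod_triangle|lra]. }
  destruct (Hn s Ks) as [N1 N2].
  set (l := ln (c n)) in *.
  set (E := exp ((sigma * Re s0 - d) * l)).
  assert (HE : Cmod (pos_cpow (c n) (RtoC sigma * s)) <= E).
  { rewrite Cmod_pos_cpow, Hre. fold l. apply exp_le.
    specialize (Hball s H). nra. }
  assert (E0 : 0 < E) by apply exp_pos.
  assert (EE : exp ((sigma * Re s0 - 2 * d) * l) = E * exp (- d * l)).
  { unfold E. rewrite <- exp_plus. f_equal. ring. }
  rewrite EE.
  assert (L1 : 1 <= exp (- d * l)).
  { rewrite <- exp_0. apply exp_le. nra. }
  assert (L2 : d * Rabs l <= exp (- d * l)).
  { rewrite Rabs_left1 by exact Hln. pose proof (exp_ineq1_le (- d * l)). lra. }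
  assert (L3 : sigma * Rabs l <= sigma / d * exp (- d * l)).
  { replace (sigma * Rabs l) with (sigma / d * (d * Rabs l)) by (field; lra).
    apply Rmult_le_compat_l; [|exact L2]. apply Rlt_le, Rdiv_lt_0_compat; lra. }
  assert (BW : 0 <= B * omega n) by (apply Rmult_le_pos; auto).
  eapply Rle_trans; [apply Cmod_triangle|]. rewrite !Cmod_mult, !Cmod_R.
  rewrite (Rabs_pos_eq sigma) by lra.
  set (P := Cmod (pos_cpow (c n) (RtoC sigma * s))) in *.
  assert (P0 : 0 <= P) by apply Cmod_ge_0.
  apply Rle_trans with (sigma / d * exp (- d * l) * E * (B * omega n) + E * (B * omega n) * exp (- d * l)).
  + apply Rplus_le_compat.
    * apply Rmult_le_compat; [| apply Cmod_ge_0 | | exact N1].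
      -- apply Rmult_le_pos; [|exact P0]. apply Rmult_le_pos; [lra|apply Rabs_pos].
      -- apply Rmult_le_compat; [|exact P0|exact L3|exact HE].
         apply Rmult_le_pos; [lra|apply Rabs_pos].
    * apply Rle_trans with (E * (B * omega n) * 1).
      -- rewrite Rmult_1_r. apply Rmult_le_compat; auto. apply Cmod_ge_0.
      -- apply Rmult_le_compat_l; [|exact L1]. apply Rmult_le_pos; lra.
  + apply Req_le. ring.
- apply (ex_series_scal_l (K := R_AbsRing) (V := R_NormedModule) ((sigma / d + 1) * B)).
  apply Hconv. unfold d. lra.
- intros s H. apply HF. specialize (Hball s H). unfold d in Hball. lra.
Qed.

Definition dirichlet_term (c : nat -> R) (w : nat -> C) (n : nat) (s : C) : C :=
  (w n * pos_cpow (c n) s)%C.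

Definition continues (c : nat -> R) (w : nat -> C) (S : R) : Prop :=
  converges_absolutely_on (half_plane S) (dirichlet_term c w) /\
  extends_meromorphically (half_plane S) (dirichlet_term c w).

Definition multiplier (c : nat -> R) (q : nat -> C) (m : R) : Prop :=
  forall w S, continues c w S -> continues c (fun n => q n * w n)%C (S - m).

Lemma continues_ext (c : nat -> R) (w w' : nat -> C) (S S' : R) :
  (forall n, w n = w' n) -> S = S' -> continues c w S -> continues c w' S'.
Proof.
intros E <- [H1 [g [H2 H3]]]. split.
- intros s Hs. generalize (H1 s Hs). apply ex_series_ext. intros n.
  unfold dirichlet_term. now rewrite E.
- exists g. split; [exact H2|]. intros s Hs. generalize (H3 s Hs).
  apply is_Cseries_ext. intros n. unfold dirichlet_term. now rewrite E.
Qed.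

Lemma multiplier_ext (c : nat -> R) (q q' : nat -> C) (m m' : R) :
  (forall n, q n = q' n) -> m = m' -> multiplier c q m -> multiplier c q' m'.
Proof.
intros E <- H w S Hw. apply (continues_ext c (fun n => q n * w n)%C _ (S - m)); auto.
intros n. now rewrite E.
Qed.

Lemma multiplier_mult (c : nat -> R) (p q : nat -> C) (l m : R) :
  multiplier c p l -> multiplier c q m -> multiplier c (fun n => p n * q n)%C (l + m).
Proof.
intros Hp Hq w S Hw.
apply (continues_ext c (fun n => p n * (q n * w n))%C _ (S - m - l)).
- intros n. ring.
- ring.
- auto.
Qed.

(** Since c^t * c^s = c^(s + t), multiplication by c^t translates the variable. *)
Lemma multiplier_monomial (c : nat -> R) (a : C) (t : R) :
  multiplier c (fun n => a * RtoC (exp (t * ln (c n))))%C t.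
Proof.
intros w S [H1 [g [H2 H3]]].
assert (E : forall n s, (a * dirichlet_term c w n (1 * s + RtoC t))%C =
   dirichlet_term c (fun n => a * RtoC (exp (t * ln (c n))) * w n)%C n s).
{ intros n s. unfold dirichlet_term. rewrite pos_cpow_plus, pos_cpow_RtoC, Cmult_1_l. ring. }
assert (HP : forall s, half_plane (S - t) s -> half_plane S (1 * s + RtoC t)%C).
{ intros s. unfold half_plane, Re; simpl. lra. }
split.
- intros s Hs. apply (ex_series_ext (fun n => Cmod a * Cmod (dirichlet_term c w n (1 * s + RtoC t)))).
  + intros n. now rewrite <- E, Cmod_mult.
  + apply (ex_series_scal_l (K := R_AbsRing) (V := R_NormedModule) (Cmod a)). apply H1. auto.
- exists (fun s => a * g (1 * s + RtoC t))%C. split.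
  + apply meromorphic_iff. intros p.
    apply (at_most_pole_mult (fun _ => a)); [intros; apply holomorphic_at_const|].
    apply at_most_pole_affine; [apply C1_nz|]. now apply meromorphic_iff.
  + intros s Hs. apply (is_Cseries_ext (fun n => a * dirichlet_term c w n (1 * s + RtoC t))%C).
    * intros n. apply E.
    * apply is_Cseries_scal, H3. auto.
Qed.

Lemma multiplier_const (c : nat -> R) (a : C) : multiplier c (fun _ => a) 0.
Proof.
apply (multiplier_ext c (fun n => a * RtoC (exp (0 * ln (c n))))%C _ 0); auto.
- intros n. rewrite Rmult_0_l, exp_0. ring.
- apply multiplier_monomial.
Qed.

Lemma multiplier_pow (c : nat -> R) (q : nat -> C) (m : R) (k : nat) :
  multiplier c q m -> multiplier c (fun n => q n ^ k)%C (INR k * m).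
Proof.
intros H. induction k as [|k IH].
- apply (multiplier_ext c (fun _ => RtoC 1) _ 0).
  + reflexivity.
  + simpl. ring.
  + apply multiplier_const.
- apply (multiplier_ext c (fun n => q n * q n ^ k)%C _ (m + INR k * m)).
  + intros n. now rewrite Cpow_S.
  + rewrite S_INR. ring.
  + now apply multiplier_mult.
Qed.

(** The terms of the expansion are continued because they are multipliers, and
the remainder of order N gives a series that converges absolutely to the right of
S - m_(N+1); [glue] joins the two. *)
Lemma multiplier_asymptotic (c : nat -> R) (q : nat -> C) (t : nat -> nat -> C) (m : nat -> R) :
  (forall n, 0 < c n) -> is_lim_seq c 0 ->
  (forall k, m k <= m (S k)) -> is_lim_seq m p_infty ->
  (forall k, multiplier c (t k) (m k)) ->
  (forall N, exists K, 0 <= K /\ eventually (fun n =>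
     Cmod (q n - Csum_n (fun k => t k n) N) <= K * exp (m (S N) * ln (c n)))) ->
  multiplier c q (m 0%nat).
Proof.
intros Hc Hl Hm Hlm Ht Hq w S Hw.
set (x := fun k => S - m k).
assert (Hx : forall k, x (Datatypes.S k) <= x k).
{ intros k. unfold x. specialize (Hm k). lra. }
assert (Habs : forall N s, half_plane (x (Datatypes.S N)) s ->
   ex_series (fun n => Cmod (dirichlet_term c (fun n => (q n - Csum_n (fun k => t k n) N) * w n)%C n s))).
{ intros N s Hs. destruct (Hq N) as [K [HK HK']].
  apply (ex_series_R_le _ (fun n => K * Cmod (dirichlet_term c w n (s + RtoC (m (Datatypes.S N)))))).
  - generalize HK'. apply filter_imp. intros n Hn.
    unfold dirichlet_term. rewrite pos_cpow_plus, pos_cpow_RtoC.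
    rewrite Rabs_pos_eq by apply Cmod_ge_0. rewrite !Cmod_mult, Cmod_R.
    rewrite (Rabs_pos_eq (exp _)) by apply Rlt_le, exp_pos.
    pose proof (Rmult_le_pos _ _ (Cmod_ge_0 (w n)) (Cmod_ge_0 (pos_cpow (c n) s))) as G.
    apply (Rmult_le_compat_r _ _ _ G) in Hn.
    eapply Rle_trans; [|eapply Rle_trans; [exact Hn|]]; apply Req_le; ring.
  - apply (ex_series_scal_l (K := R_AbsRing) (V := R_NormedModule) K). apply (proj1 Hw).
    unfold half_plane, x in *. unfold Re in *; simpl. lra. }
assert (Htw := fun k => Ht k w S Hw).
split.
- intros s Hs.
  apply (ex_series_R_le _ (fun n =>
     Cmod (dirichlet_term c (fun n => t 0%nat n * w n)%C n s) +
     Cmod (dirichlet_term c (fun n => (q n - Csum_n (fun k => t k n) 0) * w n)%C n s))).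
  + apply filter_forall. intros n. rewrite Rabs_pos_eq by apply Cmod_ge_0.
    eapply Rle_trans; [|apply Cmod_triangle]. apply Req_le. f_equal.
    unfold dirichlet_term. rewrite Csum_O. ring.
  + apply (ex_series_plus (K := R_AbsRing) (V := R_NormedModule)).
    * apply (proj1 (Htw 0%nat)). exact Hs.
    * apply Habs. unfold half_plane in *. specialize (Hx 0%nat). unfold x in *. lra.
- destruct (functional_choice _ (fun k => proj2 (Htw k))) as [T HT].
  assert (HH : forall N, exists F, forall s, x (Datatypes.S N) < 1 * Re s ->
    is_Cseries (fun n => pos_cpow (c n) (1 * s) * ((q n - Csum_n (fun k => t k n) N) * w n))%C (F s) /\
    holomorphic_at F s).
  { intros N.
    apply (dirichlet_holomorphic c 1 (fun n _ => (q n - Csum_n (fun k => t k n) N) * w n)%C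
      (fun _ _ => RtoC 0)
      (fun n => Cmod ((q n - Csum_n (fun k => t k n) N) * w n)) (x (Datatypes.S N))); auto.
    - lra.
    - intros n. apply Cmod_ge_0.
    - intros y Hy. generalize (Habs N (RtoC y) Hy). apply ex_series_ext.
      intros n. unfold dirichlet_term. rewrite Cmod_mult, Cmod_pos_cpow. reflexivity.
    - intros n s. apply is_Cderive_const.
    - intros K _. exists 1. split; [lra|]. apply filter_forall. intros n s _.
      rewrite Cmod_0, Rmult_1_l. split; [lra|apply Cmod_ge_0]. }
  destruct (functional_choice _ HH) as [H HHs].
  apply (glue _ (fun k n s => dirichlet_term c (fun n => t k n * w n)%C n s) T H x); auto.
  + apply is_lim_seq_ext with (fun k => S - m k); [reflexivity|].
    eapply is_lim_seq_minus; [apply is_lim_seq_const|exact Hlm|reflexivity].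
  + intros k. apply HT.
  + intros k. apply HT.
  + intros N s Hs. apply (is_Cseries_ext
     (fun n => pos_cpow (c n) (1 * s) * ((q n - Csum_n (fun k => t k n) N) * w n))%C).
    * intros n. unfold dirichlet_term. rewrite Cmult_1_l.
      assert (E : @eq C (Csum_n (fun k => t k n * w n * pos_cpow (c n) s)%C N)
                  (Csum_n (fun k => t k n) N * (w n * pos_cpow (c n) s))%C).
      { clear. generalize N as M. induction M as [|M IH].
        - rewrite !Csum_O. ring.
        - rewrite !Csum_Sn, IH. ring. }
      rewrite E. ring.
    * apply HHs. now rewrite Rmult_1_l.
  + intros N s Hs. apply (HHs N s). now rewrite Rmult_1_l.
Qed.

(** * The perturbed series *)

Lemma is_lim_seq_INR_scal (m : R) : 0 < m -> is_lim_seq (fun k => INR k * m) p_infty.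
Proof.
intros Hm. apply (is_lim_seq_mult _ _ p_infty m).
- apply is_lim_seq_INR.
- apply is_lim_seq_const.
- now apply is_Rbar_mult_p_infty_pos.
Qed.

Lemma exp_INR_mult (k : nat) (m l : R) : exp (INR k * m * l) = exp (m * l) ^ k.
Proof.
induction k as [|k IH].
- simpl. rewrite !Rmult_0_l. apply exp_0.
- rewrite S_INR. simpl. rewrite <- IH, <- exp_plus. f_equal. ring.
Qed.

Definition order_bound (c : nat -> R) (q : nat -> C) (m : R) : Prop :=
  exists K, 0 <= K /\ eventually (fun n => Cmod (q n) <= K * exp (m * ln (c n))).

Lemma order_bound_small (c : nat -> R) (q : nat -> C) (m r : R) :
  (forall n, 0 < c n) -> is_lim_seq c 0 -> 0 < m -> 0 < r ->
  order_bound c q m -> eventually (fun n => Cmod (q n) <= r).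
Proof.
intros Hc Hl Hm Hr [K [HK H]].
generalize (filter_and _ _ H (ln_eventually c (ln (r / (K + 1)) / m) Hc Hl)).
apply filter_imp. intros n [H1 H2].
assert (P : 0 < r / (K + 1)) by (apply Rdiv_lt_0_compat; lra).
assert (E : exp (m * ln (c n)) <= r / (K + 1)).
{ rewrite <- (exp_ln _ P). apply exp_le.
  apply (Rmult_le_compat_l m) in H2; [|lra].
  now replace (m * (ln (r / (K + 1)) / m)) with (ln (r / (K + 1))) in H2 by (field; lra). }
eapply Rle_trans; [exact H1|].
apply (Rmult_le_compat_l K) in E; [|exact HK].
eapply Rle_trans; [exact E|].
apply Rmult_le_reg_r with (K + 1); [lra|].
replace (K * (r / (K + 1)) * (K + 1)) with (K * r) by (field; lra). lra.
Qed.

(** Once c_n <= 1, the remainder O(c_n^s1) is dominated by the first term. *)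
Lemma order_bound_first (c : nat -> R) (q : nat -> C) (a : C) (s0 s1 : R) :
  (forall n, 0 < c n) -> is_lim_seq c 0 -> s0 <= s1 ->
  order_bound c (fun n => q n - a * RtoC (exp (s0 * ln (c n))))%C s1 ->
  order_bound c q s0.
Proof.
intros Hc Hl H01 [K [HK H]]. exists (K + Cmod a).
split; [pose proof (Cmod_ge_0 a); lra|].
generalize (filter_and _ _ H (ln_eventually c 0 Hc Hl)). apply filter_imp.
intros n [H1 H2].
assert (E : exp (s1 * ln (c n)) <= exp (s0 * ln (c n))) by (apply exp_le; nra).
replace (q n) with ((q n - a * RtoC (exp (s0 * ln (c n)))) + a * RtoC (exp (s0 * ln (c n))))%C by ring.
eapply Rle_trans; [apply Cmod_triangle|].
rewrite Cmod_mult, Cmod_R, (Rabs_pos_eq (exp _)) by apply Rlt_le, exp_pos.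
nra.
Qed.

(** Substituting h = O(c^m) into the Taylor expansion of log (1 + z) gives an
asymptotic expansion whose k-th term is a power of the multiplier h. *)
Lemma multiplier_log (c : nat -> R) (h ell : nat -> C) (m : R) :
  (forall n, 0 < c n) -> is_lim_seq c 0 -> 0 < m ->
  multiplier c h m -> order_bound c h m ->
  eventually (fun n => is_principal_log (1 + h n) (ell n)) ->
  multiplier c ell m /\ order_bound c ell m.
Proof.
intros Hc Hl Hm Hmul Hb Hlog.
assert (Hexp : forall N, order_bound c (fun n => ell n - log_poly N (h n))%C (INR (S (S N)) * m)).
{ intros N. destruct (log_expansion N) as [r [K [Hr [HK HE]]]].
  assert (Hsmall := order_bound_small c h m r Hc Hl Hm Hr Hb).
  destruct Hb as [B [HB Hb]].
  exists (K * B ^ S (S N)). split; [apply Rmult_le_pos; [exact HK|now apply pow_le]|].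
  generalize (filter_and _ _ Hlog (filter_and _ _ Hsmall Hb)). apply filter_imp.
  intros n [H1 [H2 H3]]. eapply Rle_trans; [apply HE; assumption|].
  rewrite exp_INR_mult, Rmult_assoc, <- Rpow_mult_distr.
  apply Rmult_le_compat_l; [exact HK|]. apply pow_incr.
  split; [apply Cmod_ge_0|exact H3]. }
split.
- apply (multiplier_ext c ell _ (INR 1 * m)); [reflexivity|simpl; ring|].
  apply (multiplier_asymptotic c ell (fun k n => log_coef k * h n ^ S k)%C (fun k => INR (S k) * m)); auto.
  + intros k. apply Rmult_le_compat_r; [lra|]. rewrite (S_INR (S k)). lra.
  + apply (is_lim_seq_incr_1 (fun k => INR k * m)). now apply is_lim_seq_INR_scal.
  + intros k. apply (multiplier_ext c (fun n => log_coef k * h n ^ S k)%C _ (0 + INR (S k) * m)).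
    * reflexivity.
    * ring.
    * apply multiplier_mult; [apply multiplier_const|now apply multiplier_pow].
- destruct (Hexp 0%nat) as [K [HK H]]. destruct Hb as [B [HB Hb]].
  exists (K + B). split; [lra|].
  generalize (filter_and _ _ (filter_and _ _ H Hb) (ln_eventually c 0 Hc Hl)).
  apply filter_imp. intros n [[H1 H2] H3].
  replace (ell n) with ((ell n - log_poly 0 (h n)) + log_poly 0 (h n))%C by ring.
  eapply Rle_trans; [apply Cmod_triangle|].
  assert (E : log_poly 0 (h n) = h n).
  { unfold log_poly. rewrite Csum_O. unfold log_coef. simpl.
    replace (1 / 1) with 1 by field. ring. }
  rewrite E in *.
  assert (exp (INR 2 * m * ln (c n)) <= exp (m * ln (c n))).
  { apply exp_le. simpl. assert (0 <= m * - ln (c n)) by (apply Rmult_le_pos; lra). lra. }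
  nra.
Qed.

(** [glue] with the Taylor expansion of exp (s * ell_n).  The factors s^k are
entire, and the remainders [exp_rem] and their derivatives are O(c_n^((N+1) m))
uniformly for bounded s. *)
Lemma extends_exp_perturbation (c : nat -> R) (a ell : nat -> C) (S0 sigma m : R) :
  (forall n, 0 < c n) -> is_lim_seq c 0 -> 0 < sigma -> 0 < m ->
  continues c a S0 -> multiplier c ell m -> order_bound c ell m ->
  let u := fun n s => (a n * (pos_cpow (c n) (RtoC sigma * s) * Cexp (s * ell n)))%C in
  converges_absolutely_on (half_plane (S0 / sigma)) u /\
  extends_meromorphically (half_plane (S0 / sigma)) u.
Proof.
intros Hc Hl Hs Hm Ha Hmul Hb u.
assert (Hre : forall s : C, Re (RtoC sigma * s) = sigma * Re s).
{ intros s. unfold Re; simpl. ring. }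
assert (Hhalf : forall S s, half_plane (S / sigma) s -> half_plane S (RtoC sigma * s)%C).
{ intros S s. unfold half_plane. rewrite Hre. intros H.
  apply (Rmult_lt_compat_l sigma) in H; [|exact Hs].
  now replace (sigma * (S / sigma)) with S in H by (field; lra). }
assert (Hhalf' : forall S s, half_plane (S / sigma) s -> S < sigma * Re s).
{ intros S s H. apply Hhalf in H. unfold half_plane in H. now rewrite Hre in H. }
split.
- intros s H.
  assert (Hsm := order_bound_small c ell m 1 Hc Hl Hm Rlt_0_1 Hb).
  apply (ex_series_R_le _ (fun n => exp (Cmod s) * Cmod (dirichlet_term c a n (RtoC sigma * s)))).
  + generalize Hsm. apply filter_imp. intros n Hn.
    rewrite Rabs_pos_eq by apply Cmod_ge_0. unfold u, dirichlet_term.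
    rewrite Cmult_assoc, Cmod_mult, Rmult_comm.
    apply Rmult_le_compat_r; [apply Cmod_ge_0|].
    eapply Rle_trans; [apply Cmod_Cexp_le|]. apply exp_le.
    rewrite Cmod_mult. pose proof (Cmod_ge_0 s). nra.
  + apply (ex_series_scal_l (K := R_AbsRing) (V := R_NormedModule) (exp (Cmod s))).
    apply (proj1 Ha). now apply Hhalf.
- assert (HT : forall k, continues c (fun n => ell n ^ k * a n)%C (S0 - INR k * m)).
  { intros k. now apply multiplier_pow. }
  destruct (functional_choice _ (fun k => proj2 (HT k))) as [g Hg].
  set (x := fun k => (S0 - INR k * m) / sigma).
  assert (Hlog : forall N, exists F, forall s, S0 - INR (S N) * m < sigma * Re s ->
     is_Cseries (fun n => pos_cpow (c n) (RtoC sigma * s) * (a n * exp_rem (S N) (s * ell n)))%C (F s) /\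
     holomorphic_at F s).
  { intros N.
    apply (dirichlet_holomorphic c sigma (fun n s => a n * exp_rem (S N) (s * ell n))%C
      (fun n s => a n * (ell n * exp_rem N (s * ell n)))%C
      (fun n => Cmod (a n) * exp (INR (S N) * m * ln (c n)))); auto.
    - intros n. apply Rmult_le_pos; [apply Cmod_ge_0|apply Rlt_le, exp_pos].
    - intros y Hy.
      apply (ex_series_ext (fun n => Cmod (dirichlet_term c a n (RtoC (y + INR (S N) * m))))).
      + intros n. unfold dirichlet_term. rewrite Cmod_mult, Cmod_pos_cpow.
        match goal with |- ?x = ?y => change (@eq R x y) end.
        change (Re (RtoC (y + INR (S N) * m))) with (y + INR (S N) * m).
        rewrite Rmult_plus_distr_r, exp_plus. ring.
      + apply (proj1 Ha). change (S0 < y + INR (S N) * m). lra.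
    - intros n s. eapply is_Cderive_eq.
      + apply (is_Cderive_mult (fun _ => a n) (fun s => exp_rem (S N) (s * ell n))).
        * apply is_Cderive_const.
        * apply (is_Cderive_comp (exp_rem (S N)) (fun s => s * ell n)%C).
          -- apply is_Cderive_exp_rem.
          -- apply (is_Cderive_mult (fun s => s) (fun _ => ell n)); [apply is_Cderive_id|apply is_Cderive_const].
      + simpl pred. ring.
    - intros K HK. destruct Hb as [B [HB Hb]].
      set (A := exp (K * B)).
      assert (HA : 0 < A) by apply exp_pos.
      assert (HKB : forall j, 0 <= (K * B) ^ j) by (intros; apply pow_le, Rmult_le_pos; assumption).
      exists ((K * B) ^ S N * A + B * ((K * B) ^ N * A)).
      split.
      { apply Rplus_le_le_0_compat; [|apply Rmult_le_pos; [exact HB|]];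
         apply Rmult_le_pos; auto; lra. }
      generalize (filter_and _ _ Hb (ln_eventually c 0 Hc Hl)). apply filter_imp.
      intros n [Hn Hln] s HsK.
      set (y := exp (m * ln (c n))) in *.
      assert (Hy : 0 < y) by apply exp_pos.
      assert (Hy1 : y <= 1) by (unfold y; rewrite <- exp_0; apply exp_le; nra).
      assert (Hsy : Cmod (s * ell n) <= K * B * y).
      { rewrite Cmod_mult, Rmult_assoc. apply Rmult_le_compat; auto; apply Cmod_ge_0. }
      assert (HAj : forall j, Cmod (exp_rem j (s * ell n)) <= (K * B) ^ j * A * y ^ j).
      { intros j. eapply Rle_trans; [apply exp_rem_bound|].
        apply Rle_trans with ((K * B * y) ^ j * A).
        - apply Rmult_le_compat.
          + apply pow_le, Cmod_ge_0.
          + apply Rlt_le, exp_pos.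
          + apply pow_incr. split; [apply Cmod_ge_0|exact Hsy].
          + apply exp_le. eapply Rle_trans; [exact Hsy|].
            rewrite <- (Rmult_1_r (K * B)) at 2.
            apply Rmult_le_compat_l; [apply Rmult_le_pos|]; assumption.
        - rewrite Rpow_mult_distr. apply Req_le. ring. }
      assert (P1 := HAj (S N)).
      assert (P2 : Cmod (ell n * exp_rem N (s * ell n)) <= B * ((K * B) ^ N * A) * y ^ S N).
      { rewrite Cmod_mult.
        replace (B * ((K * B) ^ N * A) * y ^ S N) with (B * y * ((K * B) ^ N * A * y ^ N)) by (simpl; ring).
        apply Rmult_le_compat; auto; apply Cmod_ge_0. }
      rewrite exp_INR_mult. fold y.
      assert (Y : 0 <= y ^ S N) by (apply pow_le; lra).
      assert (Q1 : 0 <= (K * B) ^ S N * A * y ^ S N).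
      { apply Rmult_le_pos; [apply Rmult_le_pos; [apply HKB|lra]|exact Y]. }
      assert (Q2 : 0 <= B * ((K * B) ^ N * A) * y ^ S N).
      { apply Rmult_le_pos; [apply Rmult_le_pos; [exact HB|apply Rmult_le_pos; [apply HKB|lra]]|exact Y]. }
      set (U := (K * B) ^ S N * A) in *. set (V := B * ((K * B) ^ N * A)) in *.
      replace ((U + V) * (Cmod (a n) * y ^ S N)) with (Cmod (a n) * (U * y ^ S N + V * y ^ S N)) by ring.
      rewrite (Cmod_mult (a n) (exp_rem (S N) (s * ell n))), (Cmod_mult (a n) (ell n * _)).
      split; (apply Rmult_le_compat_l; [apply Cmod_ge_0|lra]). }
  destruct (functional_choice _ Hlog) as [H HH].
  replace (S0 / sigma) with (x 0%nat) by (unfold x; simpl; f_equal; ring).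
  apply (glue u
    (fun k n s => s ^ k / RtoC (INR (fact k)) * dirichlet_term c (fun n => ell n ^ k * a n) n (RtoC sigma * s))%C
    (fun k s => s ^ k / RtoC (INR (fact k)) * g k (RtoC sigma * s + 0))%C H x).
  + intros k. unfold x. apply Rmult_le_compat_r; [now apply Rlt_le, Rinv_0_lt_compat|].
    rewrite S_INR. lra.
  + apply (is_lim_seq_ext (fun k => (S0 - INR k * m) * / sigma)); [reflexivity|].
    apply (is_lim_seq_mult _ _ m_infty (/ sigma)).
    * eapply is_lim_seq_minus; [apply is_lim_seq_const|now apply is_lim_seq_INR_scal|reflexivity].
    * apply is_lim_seq_const.
    * apply is_Rbar_mult_m_infty_pos. now apply Rinv_0_lt_compat.
  + intros k. apply meromorphic_iff. intros p.
    apply (at_most_pole_mult (fun s => s ^ k / RtoC (INR (fact k)))%C).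
    * intros z. apply (holomorphic_at_mult (fun s => s ^ k)%C (fun _ => / RtoC (INR (fact k)))%C);
       [|apply holomorphic_at_const].
      apply (holomorphic_at_ext_loc (fun s => (s - 0) ^ k)%C); [|apply holomorphic_at_pow].
      apply filter_forall. intros w. unfold Cminus. now rewrite Copp_0, Cplus_0_r.
    * apply at_most_pole_affine; [|apply meromorphic_iff, Hg].
      intros E. apply RtoC_inj in E. lra.
  + intros k s Hks. apply is_Cseries_scal. rewrite Cplus_0_r. apply Hg. now apply Hhalf.
  + intros N s HNs. apply (is_Cseries_ext
      (fun n => pos_cpow (c n) (RtoC sigma * s) * (a n * exp_rem (S N) (s * ell n)))%C).
    * intros n. rewrite exp_rem_sum.
      assert (E : @eq C (Csum_n (fun k => s ^ k / RtoC (INR (fact k)) *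
                 dirichlet_term c (fun n => ell n ^ k * a n) n (RtoC sigma * s))%C N)
                (pos_cpow (c n) (RtoC sigma * s) * a n *
                   Csum_n (fun k => (s * ell n) ^ k / RtoC (INR (fact k))) N)%C).
      { unfold dirichlet_term. clear. generalize N as M. induction M as [|M IH].
        - rewrite !Csum_O, Cpow_mult_l. unfold Cdiv. ring.
        - rewrite !Csum_Sn, IH, (Cpow_mult_l s (ell n)). unfold Cdiv. ring. }
      rewrite E. unfold u. ring.
    * now apply HH, Hhalf'.
  + intros N s HNs. apply (HH N s). now apply Hhalf'.
Qed.

Theorem theorem1p2
  (c : nat -> R) (a : nat -> C) (S0 sigma : R)
  (c_pos : forall n : nat, 0 < c n)
  (c_lim : is_lim_seq c 0)
  (D_conv : converges_absolutely_on (half_plane S0)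
              (fun (n : nat) (s : C) => (a n * pos_cpow (c n) s)%C))
  (D_mero : extends_meromorphically (half_plane S0)
              (fun (n : nat) (s : C) => (a n * pos_cpow (c n) s)%C))
  (sigma_pos : 0 < sigma)
  (eps t1 t2 : R)
  (eps_pos : 0 < eps)
  (t12 : 0 <= t2 - t1 < 2 * PI)
  (c_sector : forall n : nat, sector eps t1 t2 (RtoC (c n)))
  (L : C -> C)
  (L_log : log_branch (fun z : C => sector eps t1 t2 z /\ z <> RtoC 0) L)
  (h : C -> C) (alpha : nat -> C) (sig : nat -> R)
  (sig_pos : forall j : nat, 0 < sig j)
  (sig_incr : forall j : nat, sig j <= sig (S j))
  (sig_lim : is_lim_seq sig p_infty)
  (h_expansion : forall N : nat, exists CN : R, 1 < CN /\
     forall z : C, sector eps t1 t2 z ->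
       Cmod (h z - @sum_n C_AbelianMonoid
                     (fun j : nat => (alpha j * branch_pow L z (sig j))%C) N)%C
       <= CN * rpow0 (Cmod z) (sig (S N)))
  (h_neq : forall n : nat, (1 + h (RtoC (c n)))%C <> RtoC 0)
  (ell : nat -> C)
  (ell_log : forall n : nat, Cexp (ell n) = (1 + h (RtoC (c n)))%C)
  (ell_principal : forall n : nat, Cmod (h (RtoC (c n))) < 1 ->
     is_principal_log (1 + h (RtoC (c n)))%C (ell n)) :
  let u := fun (n : nat) (s : C) =>
    (a n * (pos_cpow (c n) (RtoC sigma * s) * Cexp (s * ell n)))%C in
  converges_absolutely_on (half_plane (S0 / sigma)) u /\
  extends_meromorphically (half_plane (S0 / sigma)) u.
Proof.
assert (Hne : forall n, RtoC (c n) <> 0).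
{ intros n E. apply RtoC_inj in E. specialize (c_pos n). lra. }
(* The branch is real on the positive axis, so it takes the value ln (c n) at c n. *)
assert (Hpow : forall n y, branch_pow L (RtoC (c n)) y = RtoC (exp (y * ln (c n)))).
{ intros n y. unfold branch_pow. destruct (Ceq_dec (RtoC (c n)) 0) as [E|_]; [now elim (Hne n)|].
  destruct L_log as [L1 [_ L3]].
  assert (HL := L1 (RtoC (c n)) (conj (c_sector n) (Hne n))).
  assert (HI := L3 (c n) (c_pos n) (conj (c_sector n) (Hne n))).
  assert (HE : L (RtoC (c n)) = RtoC (ln (c n))).
  { destruct (L (RtoC (c n))) as [x z]. unfold Im in HI; simpl in HI. subst z.
    change (Cexp (RtoC x) = RtoC (c n)) in HL. rewrite Cexp_RtoC in HL.
    apply RtoC_inj in HL. rewrite <- HL, ln_exp. reflexivity. }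
  now rewrite HE, <- RtoC_mult, Cexp_RtoC. }
assert (Hexp : forall N, order_bound c (fun n => h (RtoC (c n)) -
    Csum_n (fun j => alpha j * RtoC (exp (sig j * ln (c n)))) N)%C (sig (S N))).
{ intros N. destruct (h_expansion N) as [CN [HC H]]. exists CN. split; [lra|].
  apply filter_forall. intros n. specialize (H _ (c_sector n)).
  unfold rpow0 in H. rewrite Cmod_R, Rabs_pos_eq in H by (specialize (c_pos n); lra).
  destruct (Req_dec_T (c n) 0) as [E|_]; [specialize (c_pos n); lra|].
  erewrite sum_n_ext in H; [exact H|]. intros j. simpl. now rewrite Hpow. }
assert (Hmul : multiplier c (fun n => h (RtoC (c n))) (sig 0%nat)).
{ apply (multiplier_asymptotic c _ (fun j n => alpha j * RtoC (exp (sig j * ln (c n))))%C sig); auto.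
  intros k. apply multiplier_monomial. }
assert (Hb : order_bound c (fun n => h (RtoC (c n))) (sig 0%nat)).
{ apply (order_bound_first c _ (alpha 0%nat) _ (sig 1%nat)); auto.
  destruct (Hexp 0%nat) as [K [HK H]]. exists K. split; [exact HK|].
  generalize H. apply filter_imp. intros n. now rewrite Csum_O. }
destruct (multiplier_log c (fun n => h (RtoC (c n))) ell (sig 0%nat)) as [M1 M2]; auto.
{ generalize (order_bound_small c _ (sig 0%nat) (/ 2) c_pos c_lim (sig_pos 0%nat) ltac:(lra) Hb).
  apply filter_imp. intros n Hn. apply ell_principal. lra. }
apply (extends_exp_perturbation c a ell S0 sigma (sig 0%nat)); auto.
split; assumption.
Qed.
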